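(* The Chop Chop protocol (described in the context) satisfies agreement: in every execution, if a correct server delivers a message $m$ from a client $\chi$, then eventually every correct server delivers $m$ from $\chi$.
   Context: MODEL. Asynchronous message passing over authenticated reliable point-to-point links between clients, brokers, and $3f+1$ servers (a fixed known set). At most $f$ servers are Byzantine; any number of clients and brokers may be Byzantine, but at least one broker is correct. Cryptography is ideal: signatures and multi-signatures are unforgeable; multi-signatures of several processes on the same statement can be aggregated and verified; Merkle roots are collision-resistant, with proofs of inclusion. A directory $dir$ gives each client a unique integer identifier $id$, together with a transferable certified assignment ($id\leftrightarrow$ client) that anyone can import. Servers have access to a Server Total Order Broadcast (STOB) satisfying: no duplication (no message broadcast by a correct server is delivered more than once by a correct server), integrity (a delivered message was broadcast by some server), validity (a message broadcast by a correct server is eventually delivered by a correct server), agreement (a message delivered by one correct server is eventually delivered by all correct servers), total order (for different $m,m'$: if a correct server delivers $m$ without having delivered $m'$, no correct server delivers $m'$ before $m$). A statement is *certified* if it carries multi-signatures of $f+1$ distinct servers. An *evidence* with number $n$ is a certified statement $[\mathrm{Completion},r,n]$. INTERFACE. Clients trigger $\mathrm{Broadcast}(m)$; servers trigger $\mathrm{Deliver}(\chi,m)$. Correct clients obey: (CR1) a new message is broadcast only after receiving the completion certificate of the previous one; (CR2) the same message is never broadcast twice in a row. Correct brokers obey: (BR1) a new batch is sent to the servers only once the previously sent one has been delivered by STOB (at the correct servers). CLIENT $\chi$ with identifier $id$. State: counter $s=0$, an evidence, and for each pending message $m$ and broker $\beta$ a set $S_{m,\beta}$ of used sequence numbers. On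 $\mathrm{Broadcast}(m)$: mark $m$ pending and submit. Submit: choose a broker $\beta$ not yet tried for $m$, send it $[\mathrm{Submission},$ assignment of $id$, $m,s,$ signature on $[\mathrm{Message},m,s]$, evidence$]$, add $s$ to $S_{m,\beta}$, and start a finite timer; when it rings and $m$ is still pending, submit again. (By definition a submission by a correct client with $s>0$ carries an evidence with number $\ge s$.) On $[\mathrm{Inclusion},m,root,proof,k,E]$ from $\beta$, where $m$ is pending and was submitted to $\beta$: if $proof$ shows that $(id,k,m)$ is a leaf under $root$, $E$ is a valid evidence, $k\le$ number of $E$, and $k\ge s$, then set $s:=k$, store $E$, add $k$ to $S_{m,\beta}$ and send $\beta$ a multi-signature on $[\mathrm{Reduction},root]$. On $[\mathrm{Completion},r,m,k,proof,n,cert]$ from $\beta$, where $cert$ certifies $[\mathrm{Completion},r,n]$: keep it as evidence if $n$ exceeds the stored number; if $m$ is pending, $k\in S_{m,\beta}$ and $proof$ shows $(id,k,m)$ is a leaf under $r$, then set $s:=s+1$ and make $m$ no longer pending (this is receiving the completion certificate). BROKER $\beta$. Batch counter starts at 1. Import the assignment in each Submission; accept it if its signature is valid and either its sequence number is $0$ or its evidence is valid with number $\ge$ its sequence number. Accepted submissions are queued per identifier and moved into a pool containing at most one submission per identifier. When a pool is nonempty a finite timer is started; when it rings, the pool is emptied into a batch: $k$ is the maximum of its sequence numbers, $root$ is the Merkle root of all leaves $(id,k,m)$, and each client is sent $[\mathrm{Inclusion},m,root,proof,k,E]$ with $E$ the submitted evidence of largest number. After another finite timer, clients in the batch that have not sent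 a valid multi-signature on $[\mathrm{Reduction},root]$ are *stragglers*, keeping their original sequence number and signature. Let $r$ be the Merkle root of the leaves $(id,k',m)$, where $k'$ is the original sequence number for stragglers and $k'=k$ otherwise. The broker sends all servers $[\mathrm{Batch},num,ids,payloads,stragglers]$ (payloads are the pairs $(k,m)$; stragglers maps straggler identifiers to original sequence numbers), where $num$ is the batch counter, which is then incremented. On $[\mathrm{BatchAcquired},r,unknowns]$ from a server, it replies with $[\mathrm{Signatures},r,num,$ assignments of $unknowns$, aggregate of the multi-signatures, straggler signatures$]$. On collecting $f+1$ valid server multi-signatures on $[\mathrm{Witness},(r,\beta,num)]$ it aggregates them into a witness certificate $W$ and sends $[\mathrm{Witness},r,num,W]$ to all servers. On collecting $f+1$ valid matching completion shards (below) for the batch, it aggregates them into a certificate and sends to every client in the batch whose leaf is not $\bot$ the message $[\mathrm{Completion},r',m,k'',proof,n,cert]$, where $r'$ is the completion root and $(id,k'',m)$ the client's leaf in it. SERVER. State: $batches$ (map from keys $(root,broker,number)$ to batches); for each broker $\beta$ an expected number $e_\beta=1$ and an expected root (initially empty); FIFO queue $pool$; for each identifier $last[id]$, initially $(-1,\bot)$; delivery counter $c=1$; per-broker count $d_\beta=0$ of completed batches. (1) On $[\mathrm{Batch},num,ids,payloads,stragglers]$ from $\beta$: sort entries by identifier, compute the Merkle root $r$ of leaves $(id,k',m)$ with straggler sequence numbers substituted; if key $(r,\beta,num)\notin batches$, $num=e_\beta$, the expected root of $\beta$ is empty, identifiers are distinct and lengths match, then store the batch under the key, set the expected root to $r$,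 and reply $[\mathrm{BatchAcquired},r,\text{identifiers unknown to } dir]$. (2) On $[\mathrm{Signatures},r,num,\dots]$ from $\beta$: import the assignments; require that $r$ is the expected root of $\beta$, $num=e_\beta$, the batch is stored under $(r,\beta,num)$, and all its identifiers are known. Check that exactly the stragglers come with individual signatures, each valid on $[\mathrm{Message},m,\text{straggler number}]$, and that the aggregate multi-signature is valid for all other identifiers on $[\mathrm{Reduction},\rho]$, with $\rho$ the Merkle root of the leaves built from $ids$ and $payloads$ (without straggler substitution). If so, send $\beta$ a multi-signature on $[\mathrm{Witness},(r,\beta,num)]$. (3) On $[\mathrm{Witness},r,num,W]$ from $\beta$ with $r$ the expected root, $num=e_\beta$ and $W$ certifying $[\mathrm{Witness},(r,\beta,num)]$: STOB-broadcast $(\beta,r,W)$. (4) On STOB-delivery of $(\beta,r,W)$: let $key=(r,\beta,e_\beta)$; ignore unless $W$ certifies $[\mathrm{Witness},key]$. Otherwise increment $e_\beta$; if the expected root of $\beta$ is not $r$, send $[\mathrm{RequestBatch},key]$ to all servers; push $key$ into $pool$; remove $r$ from the expected root of $\beta$. (5) On $[\mathrm{RequestBatch},key]$ with $key\in batches$: reply with the stored batch and its assignments. On receiving such a reply for $key\in pool$, $key\notin batches$: import the assignments, sort by identifier, recompute the root (with straggler substitution) and store the batch under $key$ if all identifiers are known and the root equals that of $key$. (6) When the head $key=(r,\beta,num)$ of $pool$ is in $batches$: pop it and complete the batch. For each identifier in sorted order, with message $m$ and sequence number $q$ (straggler number if a straggler, payload number otherwise) and $last[id]=(q',m')$: if $q<q'$,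 the completion leaf is $\bot$; else if $m=m'$, the leaf is $(id,q',m')$; else if $q>q'$ and $m\ne m'$, set $last[id]:=(q,m)$, leaf $(id,q,m)$, and trigger $\mathrm{Deliver}(dir[id],m)$; otherwise nothing is delivered (leaf $\bot$). Send $\beta$ a completion shard: a multi-signature on $[\mathrm{Completion},\text{Merkle root of the completion leaves},c]$ together with the list of identifiers whose leaf differs from the submitted one. Then increment $c$ and $d_\beta$ and send $[\mathrm{Collection},key]$ to all servers. (7) On $[\mathrm{Collection},(r,\beta,num)]$ with $num\le d_\beta$: reply $[\mathrm{CollectionAccept},key]$. A server that has completed $key$ and received $[\mathrm{CollectionAccept},key]$ from all $3f+1$ servers deletes $key$ from $batches$.
   Formalization: In step (4), on an accepted STOB-delivery of (β,r,W), the server empties the expected root of β even when it holds a root other than r; if such a root were kept, a Byzantine broker could block a correct server forever. *)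

(* Defs.v *)
From HB Require Import structures.
From mathcomp Require Import all_boot.

Set Implicit Arguments.
Unset Strict Implicit.
Unset Printing Implicit Defensive.

Definition upd (A : eqType) (B : Type) (g : A -> B) (a : A) (b : B) : A -> B :=
  fun x => if x == a then b else g x.

Inductive proc (C B : Type) (f : nat) :=
  Client of C | Broker of B | Server of 'I_(3 * f + 1).
Arguments Client {C B f}.
Arguments Broker {C B f}.
Arguments Server {C B f}.

Section ProcEq.
Context {C B : eqType} {f : nat}.
Definition proc_code (p : proc C B f) : C + (B + 'I_(3 * f + 1)) :=
  match p with
  | Client c => inl c | Broker b => inr (inl b) | Server i => inr (inr i)
  end.
Definition proc_decode (x : C + (B + 'I_(3 * f + 1))) : proc C B f :=
  match x with
  | inl c => Client c | inr (inl b) => Broker b | inr (inr i) => Server i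
  end.
Lemma proc_codeK : cancel proc_code proc_decode. Proof. by case. Qed.
HB.instance Definition _ := Equality.copy (proc C B f) (can_type proc_codeK).
End ProcEq.

(* Ideal Merkle trees. Collision resistance is injectivity of the root;
   soundness of inclusion proofs is only required of roots of actual trees. *)
Record merkle_scheme (leaf : eqType) := MerkleScheme {
  mroot_type : eqType;
  mproof_type : Type;
  mroot : seq leaf -> mroot_type;
  mprove : seq leaf -> nat -> mproof_type;
  mverify : mroot_type -> mproof_type -> leaf -> bool;
  mroot_inj : injective mroot;
  mverify_complete : forall l i x,
    onth l i = Some x -> mverify (mroot l) (mprove l i) x;
  mverify_sound : forall l pf x, mverify (mroot l) pf x -> x \in l
}.

(* A leaf (id, sequence number, message); None is the bottom leaf. *)
Definition leaf_of (message : eqType) : eqType :=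
  option (nat * nat * message).

Record system := System {
  client : eqType;
  broker : eqType;
  message : eqType;
  faults : nat;
  ident : client -> nat;
  dir : nat -> option client;
  identK : pcancel ident dir;
  dirK : ocancel dir ident;
  merkle : merkle_scheme (leaf_of message);
  correct : pred (proc client broker faults);
  few_byzantine : #|[set i | ~~ correct (Server i)]| <= faults;
  some_broker_correct : exists b, correct (Broker b)
}.

Section Messages.
Context (S : system).

Definition server : finType := 'I_(3 * faults S + 1).
Definition process : eqType := proc (client S) (broker S) (faults S).
Definition leaf : eqType := leaf_of (message S).
Definition root : eqType := mroot_type (merkle S).
Definition proof : Type := mproof_type (merkle S).
Definition mkroot : seq leaf -> root := @mroot _ (merkle S).
Definition key : eqType := (root * broker S * nat)%type.

Inductive stmt :=
  | SMessage of message S & nat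
  | SReduction of root
  | SWitness of key
  | SCompletion of root & nat.

Definition stmt_code (x : stmt) :
    message S * nat + root + (key + root * nat) :=
  match x with
  | SMessage m s => inl (inl (m, s))
  | SReduction r => inl (inr r)
  | SWitness k => inr (inl k)
  | SCompletion r n => inr (inr (r, n))
  end.
Definition stmt_decode (x : message S * nat + root + (key + root * nat)) :=
  match x with
  | inl (inl (m, s)) => SMessage m s
  | inl (inr r) => SReduction r
  | inr (inl k) => SWitness k
  | inr (inr (r, n)) => SCompletion r n
  end.
Lemma stmt_codeK : cancel stmt_code stmt_decode. Proof. by case. Qed.
HB.instance Definition _ := Equality.copy stmt (can_type stmt_codeK).

(* Signatures are symbolic: a (multi-)signature names its signer and the
   statement, an aggregate names its set of signers and their common
   statement, and verification compares these with the expected ones. Which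
   signatures Byzantine processes can exhibit is restricted by [unforged].
   An invalid signature is one made for another signer or statement. *)
Definition signature : eqType := (process * stmt)%type.
Definition aggregate : eqType := (seq process * stmt)%type.

Definition sigs_of_aggregate (a : aggregate) : seq signature :=
  [seq (p, a.2) | p <- a.1].

Definition certifies (a : aggregate) (x : stmt) : bool :=
  (a.2 == x) && (faults S < #|[set i : server | Server i \in a.1]|).

Definition evidence := option aggregate.

(* The number of a valid evidence, None if there is none or it is invalid. *)
Definition evidence_number (E : evidence) : option nat :=
  if E is Some a then
    if a.2 is SCompletion _ n then
      if certifies a a.2 then Some n else None
    else None
  else None.

(* An assignment (id, client), whose certificate is valid iff it agrees with
   the directory. *)
Definition assignment : Type := (nat * client S)%type.
Definition valid_assignment (a : assignment) : bool := dir S a.1 == Some a.2.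

Definition import (known : seq nat) (l : seq assignment) : seq nat :=
  [seq a.1 | a <- l & valid_assignment a] ++ known.

Definition assignments_for (known ids : seq nat) : seq assignment :=
  pmap (fun id => if id \in known then omap (pair id) (dir S id) else None) ids.

Definition find_id (T : Type) (l : seq (nat * T)) (id : nat) : option T :=
  ohead [seq x.2 | x <- l & x.1 == id].

Record batch := Batch {
  entries : seq (nat * (nat * message S));
  stragglers : seq (nat * nat)
}.

Definition sort_entries : seq (nat * (nat * message S)) -> _ :=
  sort (fun x y => x.1 <= y.1).

Definition entry_seqno (b : batch) (x : nat * (nat * message S)) : nat :=
  odflt x.2.1 (find_id (stragglers b) x.1).

Definition submitted (b : batch) : seq (nat * nat * message S) :=
  [seq (x.1, entry_seqno b x, x.2.2) | x <- entries b].

Definition batch_root (b : batch) : root := mkroot (map Some (submitted b)).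

Definition reduction_root (l : seq (nat * (nat * message S))) : root :=
  mkroot [seq Some (x.1, x.2.1, x.2.2) | x <- l].

(* The identifiers whose completion leaf differs from the submitted one, each
   with its completion leaf, which the broker needs to rebuild the tree. *)
Definition exceptions := seq (nat * leaf).

Inductive netmsg :=
  | Submission of assignment & message S & nat & signature & evidence
  | Inclusion of message S & root & proof & nat & evidence
  | Reduction of signature
  | Completion of root & message S & nat & proof & nat & aggregate
  | BatchMsg of nat & seq nat & seq (nat * message S) & seq (nat * nat)
  | BatchAcquired of root & seq nat
  | Signatures of root & nat & seq assignment & aggregate &
      seq (nat * signature)
  | WitnessShard of signature
  | WitnessMsg of root & nat & aggregate
  | RequestBatch of key
  | BatchReply of key & batch & seq assignment
  | CompletionShard of signature & exceptions
  | Collection of key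
  | CollectionAccept of key.

Definition stobmsg : Type := (broker S * root * aggregate)%type.

Inductive output :=
  | Send of process & netmsg
  | StobBroadcast of stobmsg
  | Deliver of client S & message S.

Definition to_servers (x : netmsg) : seq output :=
  [seq Send (Server i) x | i <- enum server].

Definition sigs_of_evidence (E : evidence) : seq signature :=
  oapp sigs_of_aggregate [::] E.

Definition sigs_of_netmsg (x : netmsg) : seq signature :=
  match x with
  | Submission _ _ _ sg E => sg :: sigs_of_evidence E
  | Inclusion _ _ _ _ E => sigs_of_evidence E
  | Reduction sg => [:: sg]
  | Completion _ _ _ _ _ a => sigs_of_aggregate a
  | Signatures _ _ _ a l => sigs_of_aggregate a ++ map snd l
  | WitnessShard sg => [:: sg]
  | WitnessMsg _ _ a => sigs_of_aggregate a
  | CompletionShard sg _ => [:: sg]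
  | BatchMsg _ _ _ _ | BatchAcquired _ _ | RequestBatch _
  | BatchReply _ _ _ | Collection _ | CollectionAccept _ => [::]
  end.

Definition sigs_of_output (o : output) : seq signature :=
  match o with
  | Send _ x => sigs_of_netmsg x
  | StobBroadcast M => sigs_of_aggregate M.2
  | Deliver _ _ => [::]
  end.

End Messages.

Arguments SMessage {S}.
Arguments SReduction {S}.
Arguments SWitness {S}.
Arguments SCompletion {S}.
Arguments Send {S}.
Arguments StobBroadcast {S}.
Arguments Deliver {S}.

Section Client.
Context (S : system).

Record cstate := CState {
  cseq : nat;
  cevidence : evidence S;
  cpending : seq (message S);
  cused : message S * broker S -> seq nat;   (* the sets S_{m,beta} *)
  ctimers : seq (message S);                 (* running timers, a multiset *)
  clast : option (message S)                 (* last message broadcast *)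
}.

Definition cstate0 : cstate := CState 0 None [::] (fun=> [::]) [::] None.

(* The untried broker is chosen nondeterministically; None means that nothing
   is submitted when the timer rings. *)
Inductive caction :=
  | CBroadcast of message S & broker S
  | CTimer of message S & option (broker S).

Definition client_enabled (st : cstate) (a : caction) : Prop :=
  match a with
  | CBroadcast m _ =>
      cpending st = [::] (* CR1 *) /\ clast st <> Some m (* CR2 *)
  | CTimer m (Some b) =>
      [/\ m \in ctimers st, m \in cpending st & cused st (m, b) = [::]]
  | CTimer m None =>
      m \in ctimers st /\
      (m \in cpending st -> forall b, cused st (m, b) <> [::])
  end.

Definition client_submit (c : client S) (st : cstate) m b :
    cstate * seq (output S) :=
  (CState (cseq st) (cevidence st) (cpending st)
     (upd (cused st) (m, b) (cseq st :: cused st (m, b)))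
     (m :: ctimers st) (clast st),
   [:: Send (Broker b)
         (Submission (ident c, c) m (cseq st)
            (Client c, SMessage m (cseq st)) (cevidence st))]).

Definition client_act (c : client S) (st : cstate) (a : caction) :
    cstate * seq (output S) :=
  match a with
  | CBroadcast m b =>
      client_submit c
        (CState (cseq st) (cevidence st) (m :: cpending st) (cused st)
           (ctimers st) (Some m)) m b
  | CTimer m ob =>
      let st' := CState (cseq st) (cevidence st) (cpending st) (cused st)
                   (rem m (ctimers st)) (clast st) in
      if ob is Some b then client_submit c st' m b else (st', [::])
  end.

Definition client_inclusion c st b m r pf k (E : evidence S) :
    cstate * seq (output S) :=
  if [&& m \in cpending st, cused st (m, b) != [::],
         mverify r pf (Some (ident c, k, m)),
         (if evidence_number E is Some n then k <= n else false)
       & cseq st <= k] then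
    (CState k E (cpending st)
       (upd (cused st) (m, b) (k :: cused st (m, b)))
       (ctimers st) (clast st),
     [:: Send (Broker b) (Reduction (Client c, SReduction r))])
  else (st, [::]).

(* The sets S_{m,beta} only exist for pending m, so they are reset. *)
Definition client_completion (c : client S) st b (r : root S) m k pf n a :
    cstate :=
  if ~~ certifies a (SCompletion r n) then st else
  let E := if evidence_number (cevidence st) is Some n' then
             if n' < n then Some a else cevidence st
           else Some a in
  if [&& m \in cpending st, k \in cused st (m, b)
       & mverify r pf (Some (ident c, k, m))] then
    CState (cseq st).+1 E [seq x <- cpending st | x != m]
      (fun x => if x.1 == m then [::] else cused st x)
      (ctimers st) (clast st)
  else CState (cseq st) E (cpending st) (cused st) (ctimers st) (clast st).

Definition client_receive (c : client S) (st : cstate) (p : process S)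
    (x : netmsg S) : cstate * seq (output S) :=
  match p, x with
  | Broker b, Inclusion m r pf k E => client_inclusion c st b m r pf k E
  | Broker b, Completion r m k pf n a =>
      (client_completion c st b r m k pf n a, [::])
  | _, _ => (st, [::])
  end.

End Client.

Section BrokerProc.
Context (S : system).

Record submission := Sub {
  sub_id : nat;
  sub_msg : message S;
  sub_seq : nat;
  sub_sig : signature S;
  sub_evidence : evidence S
}.

(* A batch in reduction; [rb_reduced] lists the identifiers whose valid
   multi-signature on the reduction statement has been received. *)
Record rbatch := RBatch {
  rb_subs : seq submission;
  rb_seq : nat;
  rb_root : root S;
  rb_reduced : seq nat
}.

(* A batch sent to the servers, with the witness shards and the completion
   shards collected so far. *)
Record sbatch := SBatch {
  sb_red : rbatch;
  sb_num : nat;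
  sb_batch : batch S;
  sb_witness : seq (server S);
  sb_completion : seq (server S * (root S * nat))
}.

Record bstate := BState {
  bknown : seq nat;
  bqueue : nat -> seq submission;
  bpool : seq submission;
  breducing : seq rbatch;
  bready : seq rbatch;     (* stragglers determined, waiting to be sent *)
  bsent : seq sbatch;      (* most recent first *)
  bcount : nat
}.

Definition bstate0 : bstate := BState [::] (fun=> [::]) [::] [::] [::] [::] 1.

(* BEnqueue moves a queued submission into the pool, BFlush is the ringing of
   the pool timer, BExpire that of the timer of a batch in reduction with the
   given root, and BSend sends the first ready batch to the servers. *)
Inductive baction :=
  | BEnqueue of nat
  | BFlush
  | BExpire of root S
  | BSend.

Definition broker_enabled (st : bstate) (a : baction) : Prop :=
  match a with
  | BEnqueue id => bqueue st id <> [::] /\ id \notin map sub_id (bpool st)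
  | BFlush => bpool st <> [::]
  | BExpire r => r \in map rb_root (breducing st)
  | BSend => bready st <> [::]
  end.

Definition best_evidence (l : seq submission) : evidence S :=
  foldr (fun x E =>
    match evidence_number (sub_evidence x), evidence_number E with
    | Some n, Some n' => if n' < n then sub_evidence x else E
    | Some _, None => sub_evidence x
    | None, _ => E
    end) None l.

Definition broker_flush (st : bstate) : bstate * seq (output S) :=
  let subs := sort (fun x y => sub_id x <= sub_id y) (bpool st) in
  let k := \max_(x <- subs) sub_seq x in
  let leaves := [seq Some (sub_id x, k, sub_msg x) | x <- subs] : seq (leaf S) in
  let r := mkroot leaves in
  let E := best_evidence subs in
  (BState (bknown st) (bqueue st) [::]
     (RBatch subs k r [::] :: breducing st) (bready st) (bsent st) (bcount st),
   pmap (fun x : nat * submission =>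
           omap (fun c => Send (Client c)
                   (Inclusion (sub_msg x.2) r (mprove (merkle S) leaves x.1)
                      k E))
             (dir S (sub_id x.2)))
     (zip (iota 0 (size subs)) subs)).

Definition broker_expire (st : bstate) (r : root S) : bstate :=
  let l := breducing st in
  let i := find (fun rb => rb_root rb == r) l in
  BState (bknown st) (bqueue st) (bpool st) (take i l ++ drop i.+1 l)
    (bready st ++ take 1 (drop i l)) (bsent st) (bcount st).

Definition rb_stragglers (rb : rbatch) : seq submission :=
  [seq x <- rb_subs rb | sub_id x \notin rb_reduced rb].

Definition batch_of (rb : rbatch) : batch S :=
  Batch [seq (sub_id x, (rb_seq rb, sub_msg x)) | x <- rb_subs rb]
        [seq (sub_id x, sub_seq x) | x <- rb_stragglers rb].

Definition broker_send (st : bstate) : bstate * seq (output S) :=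
  if bready st is rb :: ready then
    let b := batch_of rb in
    (BState (bknown st) (bqueue st) (bpool st) (breducing st) ready
       (SBatch rb (bcount st) b [::] [::] :: bsent st) (bcount st).+1,
     to_servers (BatchMsg (bcount st) (map fst (entries b))
                   (map snd (entries b)) (stragglers b)))
  else (st, [::]).

Definition broker_act (st : bstate) (a : baction) :
    bstate * seq (output S) :=
  match a with
  | BEnqueue id =>
      (BState (bknown st) (upd (bqueue st) id (behead (bqueue st id)))
         (take 1 (bqueue st id) ++ bpool st)
         (breducing st) (bready st) (bsent st) (bcount st), [::])
  | BFlush => broker_flush st
  | BExpire r => (broker_expire st r, [::])
  | BSend => broker_send st
  end.

Definition broker_submission (st : bstate) (asg : assignment S) m s
    (sg : signature S) (E : evidence S) : bstate :=
  let id := asg.1 in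
  let q :=
    if [&& valid_assignment asg, sg == (Client asg.2, SMessage m s)
         & (s == 0) ||
           (if evidence_number E is Some n then s <= n else false)] then
      (upd (bqueue st) id (rcons (bqueue st id) (Sub id m s sg E)))
    else bqueue st in
  BState (import (bknown st) [:: asg]) q (bpool st) (breducing st)
    (bready st) (bsent st) (bcount st).

Definition broker_reduction (st : bstate) (c : client S) (sg : signature S) :
    bstate :=
  let add rb :=
    if (sg == (Client c, SReduction (rb_root rb))) &&
       (ident c \in map sub_id (rb_subs rb))
    then RBatch (rb_subs rb) (rb_seq rb) (rb_root rb) (ident c :: rb_reduced rb)
    else rb in
  BState (bknown st) (bqueue st) (bpool st) (map add (breducing st))
    (bready st) (bsent st) (bcount st).

Definition broker_acquired (st : bstate) (i : server S) (r : root S)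
    (unknowns : seq nat) : seq (output S) :=
  if [seq sb <- bsent st | batch_root (sb_batch sb) == r] is sb :: _ then
    let rb := sb_red sb in
    let reducers := [seq sub_id x | x <- rb_subs rb
                                  & sub_id x \in rb_reduced rb] in
    [:: Send (Server i)
          (Signatures r (sb_num sb) (assignments_for S (bknown st) unknowns)
             ([seq Client c | c <- pmap (dir S) reducers],
              SReduction (rb_root rb))
             [seq (sub_id x, sub_sig x) | x <- rb_stragglers rb])]
  else [::].

Definition sb_witness_shard (b : broker S) (i : server S) (sg : signature S)
    (sb : sbatch) : sbatch * seq (output S) :=
  let r := batch_root (sb_batch sb) in
  let x := SWitness (r, b, sb_num sb) in
  if (sg == (Server i, x)) && (i \notin sb_witness sb) then
    let w := i :: sb_witness sb in
    (SBatch (sb_red sb) (sb_num sb) (sb_batch sb) w (sb_completion sb),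
     if size w == (faults S).+1 then
       to_servers (WitnessMsg r (sb_num sb) (map Server w, x))
     else [::])
  else (sb, [::]).

Definition completion_leaves (b : batch S) (exc : exceptions S) :
    seq (leaf S) :=
  [seq odflt (Some x) (find_id exc x.1.1) | x <- submitted b].

Definition completion_messages (leaves : seq (leaf S)) (r : root S) (n : nat)
    (cert : aggregate S) : seq (output S) :=
  pmap (fun x : nat * leaf S =>
          if x.2 is Some (id, k, m) then
            omap (fun c => Send (Client c)
                    (Completion r m k (mprove (merkle S) leaves x.1) n cert))
              (dir S id)
          else None)
    (zip (iota 0 (size leaves)) leaves).

(* Shards do not name the batch: a shard is valid for a batch if its root is
   that of the completion leaves rebuilt from the exceptions. *)
Definition sb_completion_shard (i : server S) (sg : signature S)
    (exc : exceptions S) (sb : sbatch) : sbatch * seq (output S) :=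
  if sg.2 is SCompletion r n then
    let leaves := completion_leaves (sb_batch sb) exc in
    if [&& sg.1 == Server i, r == mkroot leaves
         & (i, (r, n)) \notin sb_completion sb] then
      let l := (i, (r, n)) :: sb_completion sb in
      let w := [seq y.1 | y <- l & y.2 == (r, n)] in
      (SBatch (sb_red sb) (sb_num sb) (sb_batch sb) (sb_witness sb) l,
       if size w == (faults S).+1 then
         completion_messages leaves r n (map Server w, SCompletion r n)
       else [::])
    else (sb, [::])
  else (sb, [::]).

Definition broker_sent_update (st : bstate)
    (f : sbatch -> sbatch * seq (output S)) : bstate * seq (output S) :=
  let l := map f (bsent st) in
  (BState (bknown st) (bqueue st) (bpool st) (breducing st) (bready st)
     (map fst l) (bcount st),
   flatten (map snd l)).

Definition broker_receive (b : broker S) (st : bstate) (p : process S)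
    (x : netmsg S) : bstate * seq (output S) :=
  match p, x with
  | _, Submission asg m s sg E => (broker_submission st asg m s sg E, [::])
  | Client c, Reduction sg => (broker_reduction st c sg, [::])
  | Server i, BatchAcquired r unknowns =>
      (st, broker_acquired st i r unknowns)
  | Server i, WitnessShard sg =>
      broker_sent_update st (sb_witness_shard b i sg)
  | Server i, CompletionShard sg exc =>
      broker_sent_update st (sb_completion_shard i sg exc)
  | _, _ => (st, [::])
  end.

End BrokerProc.

Section ServerProc.
Context (S : system).

(* In [slast], None stands for the initial pair (-1, bottom). *)
Record sstate := SState {
  sknown : seq nat;
  sbatches : key S -> option (batch S);
  snum : broker S -> nat;                       (* expected numbers *)
  sroot : broker S -> option (root S);          (* expected roots *)
  spool : seq (key S);
  slast : nat -> option (nat * message S);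
  scount : nat;
  sdone : broker S -> nat;
  scompleted : seq (key S);
  saccepts : key S -> seq (server S)
}.

Definition sstate0 : sstate :=
  SState [::] (fun=> None) (fun=> 1) (fun=> None) [::] (fun=> None) 1
    (fun=> 0) [::] (fun=> [::]).

Definition set_known (st : sstate) v : sstate :=
  SState v (sbatches st) (snum st) (sroot st) (spool st) (slast st)
    (scount st) (sdone st) (scompleted st) (saccepts st).
Definition set_batches (st : sstate) v : sstate :=
  SState (sknown st) v (snum st) (sroot st) (spool st) (slast st)
    (scount st) (sdone st) (scompleted st) (saccepts st).
Definition set_root (st : sstate) v : sstate :=
  SState (sknown st) (sbatches st) (snum st) v (spool st) (slast st)
    (scount st) (sdone st) (scompleted st) (saccepts st).
Definition set_accepts (st : sstate) v : sstate :=
  SState (sknown st) (sbatches st) (snum st) (sroot st) (spool st) (slast st)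
    (scount st) (sdone st) (scompleted st) v.

Definition server_batch (st : sstate) (b : broker S) num ids payloads strag :
    sstate * seq (output S) :=
  let B := Batch (sort_entries (zip ids payloads)) strag in
  let r := batch_root B in
  if [&& ~~ sbatches st (r, b, num), num == snum st b, ~~ sroot st b,
         uniq ids & size ids == size payloads] then
    (set_root
       (set_batches st (upd (sbatches st) (r, b, num) (Some B)))
       (upd (sroot st) b (Some r)),
     [:: Send (Broker b)
           (BatchAcquired r [seq id <- ids | id \notin sknown st])])
  else (st, [::]).

Definition signatures_valid (B : batch S) (agg : aggregate S)
    (ssigs : seq (nat * signature S)) : bool :=
  let ids := map fst (entries B) in
  let sids := map fst (stragglers B) in
  let reducers := [seq Client c | c <- pmap (dir S)
                                  [seq id <- ids | id \notin sids]] in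
  [&& all (mem sids) (map fst ssigs), all (mem (map fst ssigs)) sids,
      all (fun x : nat * signature S =>
             match find_id (entries B) x.1, find_id (stragglers B) x.1,
                   dir S x.1 with
             | Some (_, m), Some q, Some c => x.2 == (Client c, SMessage m q)
             | _, _, _ => false
             end) ssigs,
      agg.2 == SReduction (reduction_root (entries B)),
      all (mem reducers) agg.1 & all (mem agg.1) reducers].

Definition server_signatures (i : server S) (st : sstate) (b : broker S) r num
    (asgs : seq (assignment S)) agg ssigs : sstate * seq (output S) :=
  let st' := set_known st (import (sknown st) asgs) in
  (st',
   if sbatches st (r, b, num) is Some B then
     if [&& sroot st b == Some r, num == snum st b,
            all (mem (sknown st')) (map fst (entries B))
          & signatures_valid B agg ssigs] then
       [:: Send (Broker b) (WitnessShard (Server i, SWitness (r, b, num)))]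
     else [::]
   else [::]).

Definition server_witness (st : sstate) (b : broker S) r num W :
    seq (output S) :=
  if [&& sroot st b == Some r, num == snum st b
       & certifies W (SWitness (r, b, num))]
  then [:: StobBroadcast (b, r, W)] else [::].

(* The expected root of the broker is emptied, whether or not it is r: it is
   only meaningful together with the expected number, which has just been
   incremented. *)
Definition server_stob_deliver (st : sstate) (M : stobmsg S) :
    sstate * seq (output S) :=
  let: (b, r, W) := M in
  let k := (r, b, snum st b) in
  if certifies W (SWitness k) then
    (SState (sknown st) (sbatches st)
       (upd (snum st) b (snum st b).+1)
       (upd (sroot st) b None)
       (rcons (spool st) k) (slast st) (scount st) (sdone st)
       (scompleted st) (saccepts st),
     if sroot st b == Some r then [::] else to_servers (RequestBatch k))
  else (st, [::]).

Definition server_request (st : sstate) (p : process S) (k : key S) :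
    seq (output S) :=
  if sbatches st k is Some B then
    [:: Send p (BatchReply k B
                  (assignments_for S (sknown st) (map fst (entries B))))]
  else [::].

Definition server_reply (st : sstate) (k : key S) (B : batch S)
    (asgs : seq (assignment S)) : sstate :=
  if (k \in spool st) && ~~ sbatches st k then
    let st' := set_known st (import (sknown st) asgs) in
    let B' := Batch (sort_entries (entries B)) (stragglers B) in
    if all (mem (sknown st')) (map fst (entries B')) && (batch_root B' == k.1.1)
    then set_batches st' (upd (sbatches st') k (Some B'))
    else st'
  else st.

Definition server_collection (st : sstate) (p : process S) (k : key S) :
    seq (output S) :=
  if k.2 <= sdone st k.1.2 then [:: Send p (CollectionAccept k)] else [::].

(* Testing for deletion on receptions suffices: the acceptance that a server
   receives from itself answers its own Collection message, which it only
   sends after completing the key. *)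
Definition server_accept (st : sstate) (j : server S) (k : key S) : sstate :=
  let acc := upd (saccepts st) k (j :: saccepts st k) in
  let st' := set_accepts st acc in
  if (k \in scompleted st) && [forall i : server S, i \in acc k]
  then set_batches st' (upd (sbatches st') k None)
  else st'.

(* Returns the updated [last], the completion leaves and the deliveries. *)
Fixpoint complete_entries (last : nat -> option (nat * message S))
    (l : seq (nat * nat * message S)) :
    (nat -> option (nat * message S)) * seq (leaf S) * seq (output S) :=
  if l is (id, q, m) :: l' then
    let deliver :=
      (upd last id (Some (q, m)), Some (id, q, m),
       if dir S id is Some c then [:: Deliver c m] else [::]) in
    let: (last', x, o) :=
      match last id with
      | None => deliver
      | Some (q', m') =>
          if q < q' then (last, None, [::])
          else if m == m' then (last, Some (id, q', m'), [::])
          else if q' < q then deliver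
          else (last, None, [::])
      end in
    let: (last'', xs, os) := complete_entries last' l' in
    (last'', x :: xs, o ++ os)
  else (last, [::], [::]).

Definition server_complete_enabled (st : sstate) : bool :=
  if spool st is k :: _ then sbatches st k : bool else false.

Definition server_complete (i : server S) (st : sstate) :
    sstate * seq (output S) :=
  if spool st is k :: pool then
    if sbatches st k is Some B then
      let b := k.1.2 in
      let: (last, leaves, dels) := complete_entries (slast st) (submitted B) in
      let exc := [seq (x.1.1.1, x.2) | x <- zip (submitted B) leaves
                                     & x.2 != Some x.1] in
      (SState (sknown st) (sbatches st) (snum st) (sroot st) pool last
         (scount st).+1 (upd (sdone st) b (sdone st b).+1)
         (k :: scompleted st) (saccepts st),
       dels ++
       Send (Broker b)
         (CompletionShard (Server i, SCompletion (mkroot leaves) (scount st))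
            exc) ::
       to_servers (Collection k))
    else (st, [::])
  else (st, [::]).

Definition server_receive (i : server S) (st : sstate) (p : process S)
    (x : netmsg S) : sstate * seq (output S) :=
  match p, x with
  | Broker b, BatchMsg num ids payloads strag =>
      server_batch st b num ids payloads strag
  | Broker b, Signatures r num asgs agg ssigs =>
      server_signatures i st b r num asgs agg ssigs
  | Broker b, WitnessMsg r num W => (st, server_witness st b r num W)
  | Server _, RequestBatch k => (st, server_request st p k)
  | Server _, BatchReply k B asgs => (server_reply st k B asgs, [::])
  | Server _, Collection k => (st, server_collection st p k)
  | Server j, CollectionAccept k => (server_accept st j k, [::])
  | _, _ => (st, [::])
  end.

End ServerProc.

Section Executions.
Context (S : system).

Record config := Config {
  cl : client S -> cstate S;
  br : broker S -> bstate S;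
  sv : server S -> sstate S
}.

Definition config0 : config :=
  Config (fun=> cstate0 S) (fun=> bstate0 S) (fun=> sstate0 S).

(* [Receive p q x pk] is the reception by q of the message x sent by p; the
   packet pk = (t, i) is the position of the matching Send: the i-th output of
   the event that occurred at time t. *)
Inductive event :=
  | Idle
  | Receive of process S & process S & netmsg S & nat * nat
  | StobDeliver of server S & stobmsg S
  | ClientAct of client S & caction S
  | BrokerAct of broker S & baction S
  | ServerComplete of server S
  | Byzantine of process S & seq (output S).

Definition actor (e : event) : option (process S) :=
  match e with
  | Idle => None
  | Receive _ q _ _ => Some q
  | StobDeliver i _ => Some (Server i)
  | ClientAct c _ => Some (Client c)
  | BrokerAct b _ => Some (Broker b)
  | ServerComplete i => Some (Server i)
  | Byzantine p _ => Some p
  end.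

Definition upd_cl (g : config) c (r : cstate S * seq (output S)) :=
  (Config (upd (cl g) c r.1) (br g) (sv g), r.2).
Definition upd_br (g : config) b (r : bstate S * seq (output S)) :=
  (Config (cl g) (upd (br g) b r.1) (sv g), r.2).
Definition upd_sv (g : config) i (r : sstate S * seq (output S)) :=
  (Config (cl g) (br g) (upd (sv g) i r.1), r.2).

(* Byzantine processes have no state; they only act through [Byzantine]. *)
Definition step (g : config) (e : event) : config * seq (output S) :=
  if actor e is Some p then
    if correct p then
      match e with
      | Receive p (Client c) x _ => upd_cl g c (client_receive c (cl g c) p x)
      | Receive p (Broker b) x _ => upd_br g b (broker_receive b (br g b) p x)
      | Receive p (Server i) x _ => upd_sv g i (server_receive i (sv g i) p x)
      | StobDeliver i M => upd_sv g i (server_stob_deliver (sv g i) M)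
      | ClientAct c a => upd_cl g c (client_act c (cl g c) a)
      | BrokerAct b a => upd_br g b (broker_act (br g b) a)
      | ServerComplete i => upd_sv g i (server_complete i (sv g i))
      | Idle | Byzantine _ _ => (g, [::])
      end
    else if e is Byzantine _ o then (g, o) else (g, [::])
  else (g, [::]).

Section Trace.
Context (ev : nat -> event).

Fixpoint conf (t : nat) : config :=
  if t is t'.+1 then (step (conf t') (ev t')).1 else config0.

Definition outputs (t : nat) : seq (output S) := (step (conf t) (ev t)).2.

Definition emits_at (t i : nat) (p : process S) (o : output S) : Prop :=
  actor (ev t) = Some p /\ onth (outputs t) i = Some o.

Definition emits (t : nat) (p : process S) (o : output S) : Prop :=
  exists i, emits_at t i p o.

Definition delivers (t : nat) (i : server S) (c : client S) (m : message S) :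
    Prop := emits t (Server i) (Deliver c m).

Definition stob_broadcasts (t : nat) (i : server S) (M : stobmsg S) : Prop :=
  emits t (Server i) (StobBroadcast M).

Definition stob_delivers (t : nat) (i : server S) (M : stobmsg S) : Prop :=
  ev t = StobDeliver i M.

(* Byzantine processes can only exhibit the signatures of correct processes
   that these have already issued. *)
Definition unforged (t : nat) (o : seq (output S)) : Prop :=
  forall sg, sg \in flatten (map (@sigs_of_output S) o) -> correct sg.1 ->
  exists2 t', t' < t &
    exists2 y, emits t' sg.1 y & sg \in sigs_of_output y.

(* BR1: the previously sent batch has been delivered by STOB at all the
   correct servers. *)
Definition previous_delivered (t : nat) (b : broker S) : Prop :=
  if bsent (br (conf t) b) is sb :: _ then
    let r := batch_root (sb_batch sb) in
    forall i, correct (Server i) ->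
    exists2 t', t' < t &
      exists2 W, stob_delivers t' i (b, r, W)
               & certifies W (SWitness (r, b, sb_num sb))
  else True.

Definition broker_can (t : nat) (b : broker S) (a : baction S) : Prop :=
  broker_enabled (br (conf t) b) a /\
  (if a is BSend then previous_delivered t b else True).

Definition admissible (t : nat) : Prop :=
  match ev t with
  | Idle => True
  | Receive p q x (t', i) => t' < t /\ emits_at t' i p (Send q x)
  | StobDeliver _ _ => True
  | ClientAct c a => correct (Client c) /\ client_enabled (cl (conf t) c) a
  | BrokerAct b a => correct (Broker b) /\ broker_can t b a
  | ServerComplete i =>
      correct (Server i) /\ server_complete_enabled (sv (conf t) i)
  | Byzantine p o => ~~ correct p /\ unforged t o
  end.

Record reliable_links : Prop := {
  link_no_duplication : forall t t' p q x p' q' x' pk,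
    ev t = Receive p q x pk -> ev t' = Receive p' q' x' pk -> t = t';
  link_delivery : forall t i p q x, correct p -> correct q ->
    emits_at t i p (Send q x) -> exists t', ev t' = Receive p q x (t, i)
}.

Record stob : Prop := {
  stob_no_duplication : forall i j M t t1 t2,
    correct (Server i) -> correct (Server j) -> stob_broadcasts t i M ->
    stob_delivers t1 j M -> stob_delivers t2 j M -> t1 = t2;
  stob_integrity : forall j M t,
    correct (Server j) -> stob_delivers t j M ->
    exists i, exists2 t', t' < t & stob_broadcasts t' i M;
  stob_validity : forall i M t,
    correct (Server i) -> stob_broadcasts t i M ->
    exists j, exists2 t', correct (Server j) & stob_delivers t' j M;
  stob_agreement : forall i j M t,
    correct (Server i) -> correct (Server j) -> stob_delivers t i M ->
    exists t', stob_delivers t' j M;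
  stob_total_order : forall i j M M' t,
    correct (Server i) -> correct (Server j) -> M <> M' ->
    stob_delivers t i M -> (forall u, u < t -> ~ stob_delivers u i M') ->
    ~ (exists2 t', stob_delivers t' j M' &
         forall u, u < t' -> ~ stob_delivers u j M)
}.

(* Weak fairness: whatever is enabled is eventually taken or disabled. *)
Definition fair (enabled taken : nat -> Prop) : Prop :=
  forall t, enabled t -> exists2 t', t <= t' & taken t' \/ ~ enabled t'.

Record fairness : Prop := {
  fair_client : forall c m, correct (Client c) ->
    fair (fun t => m \in ctimers (cl (conf t) c))
         (fun t => exists ob, ev t = ClientAct c (CTimer m ob));
  fair_broker : forall b a, correct (Broker b) ->
    fair (fun t => broker_can t b a) (fun t => ev t = BrokerAct b a);
  fair_server : forall i, correct (Server i) ->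
    fair (fun t => server_complete_enabled (sv (conf t) i))
         (fun t => ev t = ServerComplete i)
}.

Record execution : Prop := {
  exec_admissible : forall t, admissible t;
  exec_links : reliable_links;
  exec_stob : stob;
  exec_fairness : fairness
}.

End Trace.
End Executions.

(* Submission.v *)
(* Two correct servers STOB-deliver the same messages in the same order of first
   deliveries. A repeated delivery has no effect: a certificate for the n-th
   batch of a broker contains the signature of a correct server that had already
   STOB-delivered a certificate for the batch number n - 1, so total order makes
   every correct server expect at least number n when it first delivers it.
   Hence the queues of keys of correct servers are prefixes of one another.
   Each key is eventually completed: if the batch is missing, it is requested
   from a correct server that witnessed it, which cannot have deleted it, as
   deletion needs the acceptance of the requesting server. Since Merkle roots
   are injective, equal keys mean equal batches, and the n-th completion delivers
   the same messages everywhere. *)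
Require Import Defs.
From mathcomp Require Import all_boot.
From Stdlib Require List.

Set Implicit Arguments.
Unset Strict Implicit.
Unset Printing Implicit Defensive.

(** * Histories: the sequences of keys pushed into a queue *)

Section History.
Context {S : system}.
Implicit Types (h l : seq (key S)) (k : key S) (b : broker S).

Definition from b : pred (key S) := fun k => k.1.2 == b.

(** The effect of a STOB delivery on a queue. The expected number is read off the history itself, so
    that a queue depends only on the messages delivered. *)
Definition push h (M : stobmsg S) : seq (key S) :=
  let: (b, r, W) := M in
  let k := (r, b, (count (from b) h).+1) in
  if certifies W (SWitness k) then rcons h k else h.

(** The keys of each broker bear the numbers 1, 2, 3, ... in order of appearance. *)
Definition numbered h :=
  forall l k s, h = l ++ k :: s -> k.2 = (count (from k.1.2) l).+1.

Lemma numbered_nil : numbered [::].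
Proof. by case. Qed.

Lemma numbered_catl h1 h2 : numbered (h1 ++ h2) -> numbered h1.
Proof. by move=> N l k s E; apply: (N l k (s ++ h2)); rewrite E -catA. Qed.

Lemma numbered_rcons h k :
  numbered h -> k.2 = (count (from k.1.2) h).+1 -> numbered (rcons h k).
Proof.
move=> N Ek l x s; case/lastP: s => [|s y].
  by rewrite cats1 => /eqP; rewrite eqseq_rcons => /andP[/eqP<- /eqP<-].
rewrite -rcons_cons -rcons_cat => /eqP; rewrite eqseq_rcons.
by case/andP=> /eqP/N.
Qed.

Lemma numbered_push h M : numbered h -> numbered (push h M).
Proof. by case: M => [[b r] W] N /=; case: ifP => // _; apply: numbered_rcons. Qed.

Lemma numbered_bound h k :
  numbered h -> k \in h -> 0 < k.2 <= count (from k.1.2) h.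
Proof.
move=> N /path.splitPr E; case: E N => l s /(_ l k s erefl) ->.
by rewrite count_cat /= {3}/from eqxx addnS ltnS leq_addr.
Qed.

(** Finds a key behind a counter such as [sdone]: if the number is not reached before the last key,
    then that key is from [b] and bears it. *)
Lemma numbered_exists h b n :
  numbered h -> 0 < n <= count (from b) h ->
  exists2 k, k \in h & k.1.2 = b /\ k.2 = n.
Proof.
elim/last_ind: h => [|h k IH] N; first by case: n.
rewrite -cats1 count_cat /= addn0 => /andP[n0 le_n].
case: (leqP n (count (from b) h)) => [le_h|lt_h].
  have [||x xh xP] := IH; rewrite ?n0 //.
    by apply: (@numbered_catl _ [:: k]); rewrite cats1.
  by exists x; rewrite // mem_cat xh.
exists k; first by rewrite mem_cat inE eqxx orbT.
have kb : k.1.2 = b.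
  apply/eqP; apply: contraLR (leq_trans lt_h le_n) => /negPf.
  by rewrite /from => ->; rewrite addn0 ltnn.
split=> //; rewrite (N h k [::]) ?cats1 // kb.
by apply/eqP; rewrite eqn_leq lt_h (leq_trans le_n) // /from kb eqxx addn1.
Qed.

(** A number fixes the position among the keys of its broker. *)
Lemma numbered_inj h k k' :
  numbered h -> k \in h -> k' \in h -> k.1.2 = k'.1.2 -> k.2 = k'.2 -> k = k'.
Proof.
move=> N /path.splitPr E; case: E N => l s N.
have Nk := N l k s erefl.
have Nl := numbered_catl N.
rewrite mem_cat inE => /or3P[k'l|/eqP//|k's] Eb En.
  have /andP[_] := numbered_bound Nl k'l.
  by rewrite -En -Eb Nk ltnn.
case/path.splitPr: k's N => s1 s2 N.
have := N (l ++ k :: s1) k' s2; rewrite -catA cat_cons => /(_ erefl).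
rewrite -En Nk -Eb count_cat /= {3}/from eqxx => /eqP.
by rewrite eqSS -{1}[count _ l]addn0 eqn_add2l.
Qed.

Lemma numbered_notin h1 k h2 : numbered (h1 ++ k :: h2) -> k \notin h1.
Proof.
move=> N; apply/negP => /(numbered_bound (numbered_catl N)).
by rewrite (N h1 k h2 erefl) ltnn.
Qed.

Lemma prefix_foldl_push h (s1 s2 : seq (stobmsg S)) :
  prefix (foldl push h s1) (foldl push h (s1 ++ s2)).
Proof.
rewrite foldl_cat; move: (foldl push h s1) => {}h.
elim/last_ind: s2 => [|s M IH]; first exact: prefix_refl.
rewrite foldl_rcons; apply: (prefix_trans IH).
case: M => [[b r] W] /=; case: ifP => _; rewrite ?prefix_rcons ?prefix_refl //.
Qed.

End History.

(** Outputs contain Merkle proofs, whose type need not have decidable equality; hence [List.In]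
    instead of boolean membership. *)
Lemma onth_In (T : Type) (s : seq T) n x : onth s n = Some x -> List.In x s.
Proof.
by elim: s n => [|y s IH] [|n] //=; [case=> ->; left | move/IH; right].
Qed.

Lemma In_onth (T : Type) (s : seq T) x :
  List.In x s -> exists n, onth s n = Some x.
Proof.
elim: s => //= y s IH [->|/IH[n Hn]]; first by exists 0.
by exists n.+1.
Qed.

(** Incomparable sequences have a first point of divergence, which is what total order excludes for
    logs of deliveries. *)
Lemma not_prefix_split (T : eqType) (s1 s2 : seq T) :
  prefix s1 s2 || prefix s2 s1 \/
  exists l x y s1' s2', [/\ x <> y, s1 = l ++ x :: s1' & s2 = l ++ y :: s2'].
Proof.
elim: s1 s2 => [|x s1 IH] [|y s2] /=; try by left.
case: eqVneq => [<-|/eqP xy] /=; last first.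
  by right; exists [::], x, y, s1, s2.
have [->|[l [x' [y' [s1' [s2' [xy -> ->]]]]]]] := IH s2.
  by left.
by right; exists (x :: l), x', y', s1', s2'.
Qed.

Lemma mem_prefix (T : eqType) (s1 s2 : seq T) :
  prefix s1 s2 -> {subset s1 <= s2}.
Proof. by case/prefixP=> s -> x x1; rewrite mem_cat x1. Qed.

(** * Invariants of a server *)

Section ServerInvariant.
Context {S : system}.
Implicit Types (st : sstate S) (k : key S) (b : broker S) (i : server S).

(** All keys ever pushed, oldest first ([scompleted] is most recent first); completing the head only
    moves the boundary between the two parts. *)
Definition hist st : seq (key S) := rev (scompleted st) ++ spool st.

(** What a witness vouches for, and what it needs in order to answer a request for the batch
    usefully. *)
Definition avail st k : bool :=
  if sbatches st k is Some B then all (mem (sknown st)) (map fst (entries B))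
  else false.

Definition sorted_entries (l : seq (nat * (nat * message S))) :=
  sorted (fun x y => x.1 <= y.1) l.

Definition contents_root (x : seq (nat * nat * message S)) : Defs.root S :=
  mkroot (map Some x).

Lemma contents_root_inj : injective contents_root.
Proof. by move=> x y /mroot_inj; apply: inj_map => u v []. Qed.

Definition last_after (l : seq (seq (nat * nat * message S))) :=
  foldl (fun last x => (complete_entries last x).1.1) (fun=> None) l.

(** In [sinv_last] the completed contents are quantified existentially and tied to the keys by their
    roots, since a completed batch may have been deleted from [sbatches]. *)
Record sinv st : Prop := {
  sinv_snum : forall b, snum st b = (count (from b) (hist st)).+1;
  sinv_sdone : forall b, sdone st b = count (from b) (scompleted st);
  sinv_numbered : numbered (hist st);
  sinv_batch : forall k B, sbatches st k = Some B ->
    batch_root B = k.1.1 /\ sorted_entries (entries B);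
  sinv_known : forall id, id \in sknown st -> dir S id;
  sinv_root : forall b r, sroot st b = Some r -> sbatches st (r, b, snum st b);
  sinv_last : exists2 l,
    map contents_root l = [seq k.1.1 | k <- rev (scompleted st)]
    & slast st = last_after l
}.

Lemma import_valid (known : seq nat) (asgs : seq (assignment S)) :
  (forall id, id \in known -> dir S id) ->
  forall id, id \in import known asgs -> dir S id.
Proof.
move=> K id; rewrite mem_cat => /orP[|/K//].
elim: asgs => //= a l IH; case: ifP => [/eqP v|_ //].
by rewrite inE => /orP[/eqP->|//]; rewrite v.
Qed.

Lemma sorted_sort_entries (l : seq (nat * (nat * message S))) :
  sorted_entries (sort_entries l).
Proof. by apply: sort_sorted => x y; apply: leq_total. Qed.

Lemma sort_entries_id (l : seq (nat * (nat * message S))) :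
  sorted_entries l -> sort_entries l = l.
Proof. by apply: sorted_sort => y x z; apply: leq_trans. Qed.

Lemma hist_complete i st : hist (server_complete i st).1 = hist st.
Proof.
rewrite /server_complete /hist; case E: (spool st) => [|k s] /=.
  by rewrite E.
case: (sbatches st k) => [B|]; last by rewrite E.
case: complete_entries => [[u v] w] /=.
by rewrite rev_cons -cats1 -catA.
Qed.

Lemma hist_receive i st p x : hist (server_receive i st p x).1 = hist st.
Proof.
case: p => [c|b|j]; case: x => //= *.
- by rewrite /server_batch; case: ifP.
- by rewrite /server_reply; case: ifP => // _; case: ifP.
- by rewrite /server_accept; case: ifP.
Qed.

Lemma scompleted_receive i st p x :
  scompleted (server_receive i st p x).1 = scompleted st.
Proof.
case: p => [c|b|j]; case: x => //= *.
- by rewrite /server_batch; case: ifP.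
- by rewrite /server_reply; case: ifP => // _; case: ifP.
- by rewrite /server_accept; case: ifP.
Qed.

Lemma snum_receive i st p x : snum (server_receive i st p x).1 = snum st.
Proof.
case: p => [c|b|j]; case: x => //= *.
- by rewrite /server_batch; case: ifP.
- by rewrite /server_reply; case: ifP => // _; case: ifP.
- by rewrite /server_accept; case: ifP.
Qed.

Lemma hist_stob_deliver st M :
  sinv st -> hist (server_stob_deliver st M).1 = push (hist st) M.
Proof.
case: M => [[b r] W] I /=; rewrite (sinv_snum I).
by case: ifP => //= _; rewrite /hist /= rcons_cat.
Qed.

Lemma completed_lt_snum st k :
  sinv st -> k \in hist st -> k.2 < snum st k.1.2.
Proof.
by move=> I /(numbered_bound (sinv_numbered I)); rewrite (sinv_snum I) => /andP[].
Qed.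

Lemma completed_hist st k : k \in scompleted st -> k \in hist st.
Proof. by rewrite mem_cat mem_rev => ->. Qed.

Lemma sinv0 : sinv (sstate0 S).
Proof. by split=> //; [apply: numbered_nil | exists [::]]. Qed.

Lemma sinv_batch_msg st b num ids pl strag :
  sinv st -> sinv (server_batch st b num ids pl strag).1.
Proof.
move=> I; rewrite /server_batch; case: ifP => // /and5P[] _ /eqP En _ _ _.
case: I => I1 I2 I3 I4 I5 I6 I7; split=> //=.
- move=> k B; rewrite /upd; case: eqP => [-> [<-]|_]; last by auto.
  by split=> //; apply: sorted_sort_entries.
- move=> b' r'; rewrite /upd; case: (b' =P b) => [-> [<-]|_].
    by rewrite En eqxx.
  by move=> /I6; case: ifP.
Qed.

Lemma sinv_set_known st (asgs : seq (assignment S)) :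
  sinv st -> sinv (set_known st (import (sknown st) asgs)).
Proof. by case=> *; split=> //=; apply: import_valid. Qed.

Lemma sinv_reply st k B asgs : sinv st -> sinv (server_reply st k B asgs).
Proof.
move=> I; rewrite /server_reply; case: ifP => // _.
have I' := sinv_set_known asgs I; case: ifP => // /andP[_ /eqP Er].
case: I' => I1 I2 I3 I4 I5 I6 I7; split=> //=.
- move=> k' B'; rewrite /upd; case: eqP => [-> [<-]|_]; last by auto.
  by split=> //; apply: sorted_sort_entries.
- by move=> b r /I6 /=; rewrite /upd; case: ifP.
Qed.

Lemma sinv_accept st j k : sinv st -> sinv (server_accept st j k).
Proof.
move=> I; rewrite /server_accept; case: ifP => [/andP[kc _]|_]; last first.
  by case: I => I1 I2 I3 I4 I5 I6 I7; split.
(* Only completed keys are deleted; their numbers are below the expected one, so the batch of an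
   expected root survives. *)
have lt_k := completed_lt_snum I (completed_hist kc).
case: I => I1 I2 I3 I4 I5 I6 I7; split=> //=.
- by move=> k' B'; rewrite /upd; case: eqP => // _; auto.
- move=> b r Er; rewrite /upd; case: eqP => [E|_]; last exact: I6.
  by rewrite -E /= ltnn in lt_k.
Qed.

Lemma sinv_receive i st p x : sinv st -> sinv (server_receive i st p x).1.
Proof.
move=> I; case: p => [c|b|j]; case: x => //= *.
- exact: sinv_batch_msg.
- exact: sinv_set_known.
- exact: sinv_reply.
- exact: sinv_accept.
Qed.

Lemma sinv_stob_deliver st M : sinv st -> sinv (server_stob_deliver st M).1.
Proof.
move=> I; have E := hist_stob_deliver M I.
have N := @numbered_push _ _ M (sinv_numbered I).
case: M E N => [[b r] W] /=; case: ifP => //= cW.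
rewrite -(sinv_snum I) cW => E N; split; rewrite ?E //=; try by case: I.
- move=> b'; rewrite -cats1 count_cat /= addn0 {2}/from /= /upd eq_sym.
  by rewrite (sinv_snum I b'); case: eqP => [->|_]; rewrite ?addn1 ?addn0 // (sinv_snum I).
- move=> b' r'; rewrite /upd; case: (b' =P b) => // _; exact: (sinv_root I).
Qed.

Lemma sinv_complete i st : sinv st -> sinv (server_complete i st).1.
Proof.
move=> I; have E := hist_complete i st.
rewrite /server_complete in E *; case: (spool st) E => // k s.
case EB: (sbatches st k) => [B|] //.
case C: complete_entries => [[u v] w] /= E.
have [r_B _] := sinv_batch I EB.
case: I => I1 I2 I3 I4 I5 I6 I7; split; rewrite ?E //=.
- by move=> b; rewrite /upd {1}/from eq_sym I2; case: eqP => [<-|].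
- case: I7 => l El Es; exists (rcons l (submitted B)).
    by rewrite rev_cons !map_rcons El -r_B.
  by rewrite /last_after foldl_rcons -/(last_after l) -Es C.
Qed.

(** A stored batch is never overwritten, because both ways of storing test that the key is free; it
    can only be deleted, by a [CollectionAccept]. *)
Lemma stored_receive i st p x k B : sinv st ->
  sbatches st k = Some B -> sbatches (server_receive i st p x).1 k = Some B \/
  k \in scompleted st /\
  forall j, j \in saccepts (server_receive i st p x).1 k.
Proof.
move=> I Ek; case: p => [c|b|j]; case: x => //=; try by left.
- move=> num ids pl strag; rewrite /server_batch; case: ifP; last by left.
  case/andP=> nst _; left=> /=; rewrite /upd; case: eqP => // E.
  by rewrite -E Ek in nst.
- move=> k' B' asgs; rewrite /server_reply; case: ifP; last by left.
  case/andP=> _ nst; left; case: ifP => //= _; rewrite /upd; case: eqP => // E.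
  by rewrite -E Ek in nst.
- move=> k'; rewrite /server_accept; case: ifP => /=; last by left.
  case/andP=> kc /forallP acc; case: (k =P k') => [->|/eqP/negPf ne]; last first.
    by left; rewrite /upd ne.
  by right.
Qed.

Lemma stored_stob_deliver st M : sbatches (server_stob_deliver st M).1 = sbatches st.
Proof. by case: M => [[b r] W] /=; case: ifP. Qed.

Lemma stored_complete i st : sbatches (server_complete i st).1 = sbatches st.
Proof.
rewrite /server_complete; case: (spool st) => // k s.
by case: (sbatches st k) => // B; case: complete_entries => [[u v] w].
Qed.

Lemma known_receive i st p x id :
  id \in sknown st -> id \in sknown (server_receive i st p x).1.
Proof.
move=> K; case: p => [c|b|j]; case: x => //= *.
- by rewrite /server_batch; case: ifP.
- by rewrite mem_cat K orbT.
- by rewrite /server_reply; case: ifP => // _; case: ifP => /=; rewrite mem_cat K orbT.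
- by rewrite /server_accept; case: ifP.
Qed.

Lemma known_stob_deliver st M : sknown (server_stob_deliver st M).1 = sknown st.
Proof. by case: M => [[b r] W] /=; case: ifP. Qed.

Lemma known_complete i st : sknown (server_complete i st).1 = sknown st.
Proof.
rewrite /server_complete; case: (spool st) => // k s.
by case: (sbatches st k) => // B; case: complete_entries => [[u v] w].
Qed.

(** Importing what a server attaches to a batch makes known all the identifiers that the sender
    knew. *)
Lemma mem_import_assignments (known known' ids : seq nat) id :
  id \in ids -> id \in known' -> dir S id ->
  id \in import known (assignments_for S known' ids).
Proof.
move=> idl idk; case Ed: (dir S id) => [c|] // _.
rewrite mem_cat; apply/orP; left.
elim: ids idl => //= a l IH; rewrite inE => /orP[/eqP<-|/IH{}IH].
  by rewrite idk Ed /= /valid_assignment /= Ed eqxx /= mem_head.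
case: ifP => //= _; case Ea: (dir S a) => [d|] //=.
by rewrite /valid_assignment /= Ea eqxx /= inE IH orbT.
Qed.

(* A retransmitted batch is accepted: it is already sorted, hence has the
   expected root, and all its assignments are attached. *)
Lemma reply_stored st st' k B :
  sinv st' -> avail st' k -> sbatches st' k = Some B -> k \in spool st ->
  sbatches (server_reply st k B
              (assignments_for S (sknown st') (map fst (entries B)))) k.
Proof.
move=> I'; rewrite /avail => av E; rewrite E in av => kp.
have [Er Es] := sinv_batch I' E.
rewrite /server_reply kp /=; case st_k: (sbatches st k) => [B'|] /=.
  by rewrite st_k.
rewrite (sort_entries_id Es); case: B E av Er {Es} => en sg E /= av Er.
rewrite Er eqxx andbT; set known' := import _ _.
have -> : all (mem known') (map fst en).
  apply/allP => id idl /=; apply: mem_import_assignments => //.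
    exact: (allP av).
  by apply: (sinv_known I'); apply: (allP av).
by rewrite /= /upd eqxx.
Qed.

Lemma saccepts_receive i st p x j k :
  j \in saccepts (server_receive i st p x).1 k ->
  j \in saccepts st k \/ p = Server j /\ x = CollectionAccept k.
Proof.
case: p => [c|b|j']; case: x => /=; try by left.
- by move=> num ids pl strag; rewrite /server_batch; case: ifP; left.
- move=> k' B asgs; rewrite /server_reply.
  by case: ifP => _; [case: ifP|]; left.
- move=> k'; rewrite /server_accept.
  have E (a : bool) u v : saccepts u = saccepts v :> (key S -> seq (server S)) ->
      saccepts (if a then u else v) = saccepts v by case: a.
  rewrite E // /= /upd; case: eqP => [->|_]; last by left.
  by rewrite inE => /orP[/eqP->|]; [right | left].
Qed.

Lemma to_servers_In o (x : netmsg S) :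
  List.In o (to_servers x) -> exists i, o = Send (Server i) x.
Proof.
rewrite /to_servers; elim: (enum _) => //= i l IH [<-|//].
by exists i.
Qed.

Lemma complete_entries_In (last : nat -> option (nat * message S)) l o :
  List.In o (complete_entries last l).2 -> exists c m, o = Deliver c m.
Proof.
elim: l last => //= -[[id q] m] l IH last.
set d := (match last id with None => _ | Some _ => _ end).
have : List.In o d.2 -> exists c m, o = Deliver c m.
  have dl : List.In o (if dir S id is Some c then [:: Deliver c m] else [::]) ->
      exists c m, o = Deliver c m.
    by case: (dir S id) => //= c [<-|//]; exists c, m.
  rewrite /d; case: (last id) => [[q' m']|] //.
  by case: ifP => // _; case: ifP => // _; case: ifP.
case: d => -[u v] w /= fw; have := IH u.
case: complete_entries => -[u' v'] w' /= fw'.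
by case/List.in_app_iff.
Qed.

(** Acceptances only answer [Collection] messages, and the answer is guarded by this inequality. *)
Lemma sent_accept_receive i i' st p x k :
  List.In (Send (Server i') (CollectionAccept k)) (server_receive i st p x).2 ->
  k.2 <= sdone st k.1.2.
Proof.
case: p => [c|b|j]; case: x => //=.
- by move=> num ids pl strag; rewrite /server_batch; case: ifP => //= _ [].
- move=> r num asgs agg ssigs; case: (sbatches st _) => // B.
  by case: ifP => //= _ [].
- by move=> r num W; rewrite /server_witness; case: ifP => //= _ [].
- by move=> k'; rewrite /server_request; case: (sbatches st k') => //= B [].
- move=> k'; rewrite /server_collection; case: ifP => //= le_k [] // [_ <-].
  exact: le_k.
Qed.

Lemma sent_accept_stob q st M k :
  List.In (Send q (CollectionAccept k)) (server_stob_deliver st M).2 -> False.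
Proof.
case: M => [[b r] W] /=; case: ifP => //= _; case: ifP => //= _.
by move/to_servers_In=> [].
Qed.

Lemma sent_accept_complete q i st k :
  List.In (Send q (CollectionAccept k)) (server_complete i st).2 -> False.
Proof.
rewrite /server_complete; case: (spool st) => // k' s.
case: (sbatches st k') => // B.
have := @complete_entries_In (slast st) (submitted B).
case: complete_entries => -[u v] w /= dw.
case/List.in_app_iff=> [/dw[? [?]]//|/= [//|/to_servers_In[]]] //.
Qed.

(** With [deliver_stob], this leaves completion as the only source of deliveries. *)
Lemma deliver_receive i st p x c m :
  List.In (Deliver c m) (server_receive i st p x).2 -> False.
Proof.
case: p => [d|b|j]; case: x => //=.
- by move=> num ids pl strag; rewrite /server_batch; case: ifP => //= _ [].
- move=> r num asgs agg ssigs; case: (sbatches st _) => // B.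
  by case: ifP => //= _ [].
- by move=> r num W; rewrite /server_witness; case: ifP => //= _ [].
- by move=> k'; rewrite /server_request; case: (sbatches st k') => //= B [].
- by move=> k'; rewrite /server_collection; case: ifP => //= _ [].
Qed.

Lemma deliver_stob st M c m :
  List.In (Deliver c m) (server_stob_deliver st M).2 -> False.
Proof.
case: M => [[b r] W] /=; case: ifP => //= _; case: ifP => //= _.
by move/to_servers_In=> [].
Qed.

End ServerInvariant.

(** * Witness signatures *)

Section WitnessSignature.
Context {S : system} (i0 : server S) (k0 : key S).

(** One witness signature is fixed and followed through the whole system; the [free_] predicates
    express that it is absent from a message, an output or a state. *)
Definition wsig : signature S := (Server i0, SWitness k0).
Definition free_output (o : output S) := wsig \notin sigs_of_output o.
Definition free_msg (x : netmsg S) := wsig \notin sigs_of_netmsg x.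
Definition free_evidence (E : evidence S) := wsig \notin sigs_of_evidence E.

Lemma free_send q x : free_output (Send q x) = free_msg x.
Proof. by []. Qed.

Lemma free_to_servers x : free_msg x -> all free_output (to_servers x).
Proof. by move=> fx; rewrite all_map; apply/allP. Qed.

Lemma wsig_aggregate (l : seq (process S)) x :
  (wsig \in sigs_of_aggregate (l, x)) = (Server i0 \in l) && (x == SWitness k0).
Proof.
apply/mapP/andP => [[p pl [-> ->]]|[il /eqP->]]; first by rewrite pl.
by exists (Server i0).
Qed.

Lemma free_client_submit c st m b : free_evidence (cevidence st) ->
  free_evidence (cevidence (client_submit c st m b).1) /\
  all free_output (client_submit c st m b).2.
Proof.
by move=> fE; split=> //=; rewrite andbT /free_output /= inE negb_or andTb.
Qed.

Lemma free_client_act c st a : free_evidence (cevidence st) ->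
  free_evidence (cevidence (client_act c st a).1) /\
  all free_output (client_act c st a).2.
Proof. by case: a => [m b|m [b|]] //= fE; apply: free_client_submit. Qed.

Lemma free_client_receive c st p x :
  free_evidence (cevidence st) -> free_msg x ->
  free_evidence (cevidence (client_receive c st p x).1) /\
  all free_output (client_receive c st p x).2.
Proof.
move=> fE; case: p => [d|b|i]; case: x => //=.
  by move=> m r pf k E fx; rewrite /client_inclusion; case: ifP.
move=> r m k pf n a fx; split=> //; rewrite /client_completion.
have fE' : free_evidence (if evidence_number (cevidence st) is Some n'
  then if n' < n then Some a else cevidence st else Some a).
  by case: evidence_number => // n'; case: ifP.
by case: ifP => // _; case: ifP.
Qed.

Definition free_sub (x : submission S) :=
  (sub_sig x != wsig) && free_evidence (sub_evidence x).
Definition free_rbatch (rb : rbatch S) := all free_sub (rb_subs rb).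
(** A sent batch records the signers of its witness shards and not the signatures, so holding the
    fixed signature means that [i0] is recorded for a batch with key [k0]. *)
Definition free_sbatch b (sb : sbatch S) :=
  free_rbatch (sb_red sb) &&
  ~~ ((i0 \in sb_witness sb) &&
      ((batch_root (sb_batch sb), b, sb_num sb) == k0)).

Record free_bstate b (st : bstate S) : Prop := {
  free_bqueue : forall id, all free_sub (bqueue st id);
  free_bpool : all free_sub (bpool st);
  free_breducing : all free_rbatch (breducing st);
  free_bready : all free_rbatch (bready st);
  free_bsent : all (free_sbatch b) (bsent st)
}.

Lemma all_take (T : Type) (a : pred T) n s : all a s -> all a (take n s).
Proof. by rewrite -{1}(cat_take_drop n s) all_cat => /andP[]. Qed.

Lemma all_drop (T : Type) (a : pred T) n s : all a s -> all a (drop n s).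
Proof. by rewrite -{1}(cat_take_drop n s) all_cat => /andP[]. Qed.

Lemma free_best_evidence l : all free_sub l -> free_evidence (best_evidence l).
Proof.
elim: l => //= x l IH /andP[/andP[_ fx] /IH fl].
case: evidence_number => // n; case: evidence_number => // n'.
by case: ifP.
Qed.

Lemma all_pmap (T U : Type) (a : pred U) (g : T -> option U) (s : seq T) :
  (forall x y, g x = Some y -> a y) -> all a (pmap g s).
Proof.
move=> H; elim: s => //= x s IH.
by case E: (g x) => [y|] //=; rewrite (H _ _ E).
Qed.

Lemma free_broker_act b st a : free_bstate b st ->
  free_bstate b (broker_act st a).1 /\ all free_output (broker_act st a).2.
Proof.
case=> fq fp fr fy fs; case: a => [id||r|] /=.
- split=> //; split=> //=.
    move=> id'; rewrite /upd; case: eqP => // _.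
    by have := fq id; case: (bqueue st id) => //= x s /andP[].
  by rewrite all_cat fp andbT; apply/all_take.
- rewrite /broker_flush /=; set subs := sort _ _.
  have f_subs : all free_sub subs by rewrite all_sort.
  split; first by split=> //=; rewrite /free_rbatch f_subs.
  apply: all_pmap => -[n x] y /=; case: (dir S _) => //= c [<-].
  exact: free_best_evidence.
- split=> //; split=> //=; rewrite all_cat ?fy ?all_take ?all_drop //.
- rewrite /broker_send; case E: (bready st) fy => [|rb s] /=.
    by move=> _; split=> //; split; rewrite ?E.
  case/andP=> f_rb f_s; split; first by split=> //=; rewrite fs andbT /free_sbatch /= f_rb.
  by apply: free_to_servers.
Qed.

Lemma free_broker_receive b st p x : free_bstate b st -> free_msg x ->
  free_bstate b (broker_receive b st p x).1 /\
  all free_output (broker_receive b st p x).2.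
Proof.
case=> fq fp fr fy fs fx.
have sub asg m s sg E : free_msg (Submission asg m s sg E) ->
    free_bstate b (broker_submission st asg m s sg E).
  rewrite /free_msg /= inE negb_or eq_sym => /andP[f_sg f_E].
  split=> //= id; case: ifP => // _; rewrite /upd; case: eqP => // _.
  by rewrite all_rcons fq andbT /free_sub /= f_sg.
have fsplit (g : sbatch S -> sbatch S * seq (output S)) :
    (forall sb, free_sbatch b sb ->
       free_sbatch b (g sb).1 && all free_output (g sb).2) ->
    free_bstate b (broker_sent_update st g).1 /\
    all free_output (broker_sent_update st g).2.
  move=> Hg; have : all (fun y => free_sbatch b y.1 && all free_output y.2)
                      (map g (bsent st)).
    by rewrite all_map; apply: sub_all fs => sb /Hg.
  rewrite all_predI => /andP[f1 f2].
  split; first by split=> //=; rewrite all_map.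
  rewrite /=; elim: (bsent st) f2 => //= sb l IH /andP[f_sb /IH f_l].
  by rewrite all_cat f_sb.
case: p => [c|b'|i]; case: x fx => //=; try by split; auto.
- move=> sg f_sg; split=> //; split=> //=; rewrite all_map.
  by apply: sub_all fr => rb /=; case: ifP.
- move=> r unk _; split=> //; rewrite /broker_acquired.
  have : all (free_sbatch b)
      [seq sb <- bsent st | batch_root (sb_batch sb) == r].
    by rewrite all_filter; apply: sub_all fs => sb /= ->; rewrite implybT.
  case: [seq _ <- _ | _] => //= sb _ /andP[/andP[f_sb _] _]; rewrite andbT.
  (* The aggregate is on a reduction, so only the straggler signatures remain; they come from
     submissions. *)
  rewrite free_send /free_msg /= mem_cat negb_or wsig_aggregate andbF /=.
  rewrite -map_comp; apply: contraTN f_sb; rewrite /rb_stragglers.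
  rewrite /free_rbatch; elim: (rb_subs _) => //= y s IH.
  case: ifP => _ /=; rewrite ?inE negb_and; last by move/IH->; rewrite orbT.
  case/orP=> [/eqP E|/IH->]; last by rewrite orbT.
  by rewrite /free_sub -E eqxx.
- move=> sg f_sg; apply: fsplit => sb f_sb; rewrite /sb_witness_shard.
  case: ifP => /=; last by rewrite f_sb.
  case/andP: (f_sb) => f_rb f_w /andP[/eqP E _].
  (* If [i0] is newly recorded for the key [k0], then the shard just received was the fixed
     signature. *)
  have f_w' : ~~ ((i0 \in i :: sb_witness sb) &&
      ((batch_root (sb_batch sb), b, sb_num sb) == k0)).
    rewrite inE; case: (i0 =P i) => //= ei; apply: contra f_sg => /eqP ek.
    by rewrite E inE /wsig ei ek.
  rewrite /free_sbatch /= f_rb f_w' /=; case: ifP => // _.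
  apply: free_to_servers; rewrite /free_msg /= wsig_aggregate.
  apply: contra f_w' => /andP[im /eqP[->]]; rewrite eqxx andbT.
  by move: im; rewrite -map_cons mem_map // => ? ? [].
- move=> sg exc f_sg; apply: fsplit => sb f_sb; rewrite /sb_completion_shard.
  case: sg.2 => *; rewrite /= ?f_sb //.
  case: ifP => /=; rewrite ?f_sb // => _.
  rewrite {1}/free_sbatch /= -/(free_sbatch b sb) f_sb /=.
  case: ifP => // _; apply: all_pmap => -[n' [[[id q] m]|]] y //=.
  case: (dir S id) => //= c [<-].
  by rewrite free_send /free_msg /= wsig_aggregate andbF.
Qed.

Lemma free_complete_entries last l :
  all free_output (@complete_entries S last l).2.
Proof.
elim: l last => //= -[[id q] m] l IH last.
set d := (match last id with None => _ | Some _ => _ end).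
have : all free_output d.2.
  rewrite /d; case: (last id) => [[q' m']|]; last by case: (dir S id).
  by case: ifP => // _; case: ifP => // _; case: ifP => // _; case: (dir S id).
case: d => -[u v] w /= fw; have := IH u.
by case: complete_entries => -[u' v'] w' /= fw'; rewrite all_cat fw.
Qed.

Lemma free_server_complete i st : all free_output (server_complete i st).2.
Proof.
rewrite /server_complete; case: (spool st) => // k s.
case: (sbatches st k) => // B.
have := free_complete_entries (slast st) (submitted B).
case: complete_entries => -[u v] w /= fw; rewrite all_cat fw /=.
by rewrite free_to_servers // andbT free_send /free_msg /= inE; apply/eqP => -[].
Qed.

Lemma free_server_stob_deliver st M :
  all free_output (server_stob_deliver st M).2.
Proof.
case: M => [[b r] W] /=; case: ifP => // _; case: ifP => // _.
exact: free_to_servers.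
Qed.

(** A server that was not sent the signature emits it only after the checks on [Signatures], which
    imply the conclusion. The state is the one after the reception, as the checks use the
    assignments just imported. *)
Lemma free_server_receive i st p x : free_msg x ->
  ~~ all free_output (server_receive i st p x).2 ->
  [/\ i = i0, avail (server_receive i st p x).1 k0 &
      snum (server_receive i st p x).1 k0.1.2 = k0.2].
Proof.
move=> fx; case: p => [c|b|j]; case: x fx => //=.
- by move=> num ids pl strag _; rewrite /server_batch; case: ifP.
- move=> r num asgs agg ssigs _; rewrite /avail /=.
  case E: (sbatches st (r, b, num)) => [B|] //=.
  case: ifP => // /and4P[_ /eqP En K _] /=; rewrite andbT negbK.
  rewrite /free_output /= inE => /eqP[-> ->] /=.
  by rewrite E En.
- move=> r num W fx; rewrite /server_witness; case: ifP => //= _.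
  by rewrite andbT => /negP.
- move=> k _; rewrite /server_request.
  by case: (sbatches st k).
- by move=> k _; rewrite /server_collection; case: ifP.
Qed.

End WitnessSignature.

(** * Executions *)

Lemma all_onth (T : Type) (a : pred T) s n x :
  all a s -> onth s n = Some x -> a x.
Proof. by elim: s n => [|y s IH] [|n] //= /andP[ay /IH{}IH]; [case=> <- | apply: IH]. Qed.

Section Execution.
Context {S : system} (ev : nat -> event S) (exec : execution ev).

Let adm t : admissible ev t := exec_admissible exec t.

(** One event as seen by server [i]. Events of other processes fall under [StepIdle], so an
    invariant of a correct server has four cases. *)
Variant server_step i t : sstate S -> seq (output S) -> Prop :=
  | StepIdle : server_step i t (sv (conf ev t) i) [::]
  | StepReceive p x pk of ev t = Receive p (Server i) x pk :
      server_step i t (server_receive i (sv (conf ev t) i) p x).1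
                      (server_receive i (sv (conf ev t) i) p x).2
  | StepStob M of ev t = StobDeliver i M :
      server_step i t (server_stob_deliver (sv (conf ev t) i) M).1
                      (server_stob_deliver (sv (conf ev t) i) M).2
  | StepComplete of ev t = ServerComplete i
                  & server_complete_enabled (sv (conf ev t) i) :
      server_step i t (server_complete i (sv (conf ev t) i)).1
                      (server_complete i (sv (conf ev t) i)).2.

Definition server_outputs i t : seq (output S) :=
  if actor (ev t) == Some (Server i) then outputs ev t else [::].

Lemma server_stepP i t : correct (Server i) ->
  server_step i t (sv (conf ev t.+1) i) (server_outputs i t).
Proof.
move=> ci; have := adm t; rewrite /admissible /server_outputs /outputs /=.
case E: (ev t) => [|p q x [t' n]|j M|c a|b a|j|p o] /=.
- by move=> _; apply: StepIdle.
- move=> _; rewrite /step /=; case: (q =P Server i) => [Eq|nq].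
    rewrite Eq eqxx ci /= /upd eqxx; rewrite Eq in E.
    exact: StepReceive E.
  case: eqP => [[/nq]|_] //; case: ifP => // _; last exact: StepIdle.
  case: q nq {E} => [c|b|j] nq; try exact: StepIdle.
  rewrite /= /upd; case: eqP => [Ei|_]; last exact: StepIdle.
  by case: nq; rewrite Ei.
- move=> _; rewrite /step /=; case: (j =P i) => [Ej|nj].
    rewrite Ej eqxx ci /= /upd eqxx; rewrite Ej in E.
    exact: StepStob E.
  case: eqP => [[/nj]|_] //; case: ifP => // _; last exact: StepIdle.
  by rewrite /= /upd; case: eqP => [Ei|_]; [case: nj | exact: StepIdle].
- by move=> _; rewrite /step /=; case: ifP => _; apply: StepIdle.
- by move=> _; rewrite /step /=; case: ifP => _; apply: StepIdle.
- rewrite /step /= => -[cj en]; rewrite cj; case: (j =P i) => [Ej|nj].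
    rewrite Ej eqxx /= /upd eqxx; rewrite Ej in E en.
    exact: StepComplete E en.
  case: eqP => [[/nj]|_] //.
  by rewrite /= /upd; case: eqP => [Ei|_]; [case: nj | exact: StepIdle].
- case=> np _; rewrite /step /= (negPf np) /=.
  by case: eqP => [[Ep]|_]; [rewrite Ep ci in np | exact: StepIdle].
Qed.

Lemma server_emits i t o : emits ev t (Server i) o ->
  exists n, onth (server_outputs i t) n = Some o.
Proof.
by case=> n [Ea En]; exists n; rewrite /server_outputs Ea eqxx.
Qed.

Section Origin.
Context (i0 : server S) (k0 : key S) (ci0 : correct (Server i0)).

Definition free_config (g : config S) : Prop :=
  (forall c, free_evidence i0 k0 (cevidence (cl g c))) /\
  (forall b, free_bstate i0 k0 b (br g b)).

Definition witnessing u : bool :=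
  avail (sv (conf ev u) i0) k0 && (snum (sv (conf ev u) i0) k0.1.2 == k0.2).

(** Induction on time: as long as [i0] has never been in a witnessing state, correct processes
    neither store nor emit its signature, and Byzantine ones cannot invent it. *)
Lemma free_execution t : (forall u, u <= t -> ~~ witnessing u) ->
  free_config (conf ev t) /\
  (forall u, u < t -> all (free_output i0 k0) (outputs ev u)).
Proof.
elim: t => [|t IH] nw; first by split.
have [|[fc fb] fo] := IH; first by move=> u /leqW/nw.
suff [fg f_t] : free_config (conf ev t.+1) /\
    all (free_output i0 k0) (outputs ev t).
  by split=> // u; rewrite ltnS leq_eqVlt => /orP[/eqP->|/fo].
have f_received p q x t' n : t' < t -> emits_at ev t' n p (Send q x) ->
    free_msg i0 k0 x.
  by move=> lt_t [_ /(all_onth (fo _ lt_t))].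
have upd_c c (r : cstate S * seq (output S)) :
    free_evidence i0 k0 (cevidence r.1) /\ all (free_output i0 k0) r.2 ->
    free_config (upd_cl (conf ev t) c r).1 /\
    all (free_output i0 k0) (upd_cl (conf ev t) c r).2.
  by case=> f1 f2; split=> //; split=> //= c'; rewrite /upd; case: eqP.
have upd_b b (r : bstate S * seq (output S)) :
    free_bstate i0 k0 b r.1 /\ all (free_output i0 k0) r.2 ->
    free_config (upd_br (conf ev t) b r).1 /\
    all (free_output i0 k0) (upd_br (conf ev t) b r).2.
  by case=> f1 f2; split=> //; split=> //= b'; rewrite /upd; case: eqP => [->|].
have := adm t; rewrite /admissible /outputs /=.
have nw_t := nw t.+1 (leqnn _).
case E: (ev t) => [|p q x [t' n]|j M|c a|b a|j|p o] //=.
- case=> lt_t /(f_received _ _ _ _ _ lt_t) fx; rewrite /step /=.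
  case: ifP => // cq; case: q E cq => [c|b|j] E cj.
  + by apply: upd_c; apply: free_client_receive.
  + by apply: upd_b; apply: free_broker_receive.
  (* A server emitting the signature would be [i0] itself, in a witnessing state at [t.+1]. *)
  + split=> //=; apply: contraNT nw_t => /(free_server_receive fx).
    case=> Ej; rewrite Ej in E cj *; move=> av En.
    by rewrite /witnessing /= E /step /= cj /= /upd eqxx av En eqxx.
- move=> _; rewrite /step /=; case: ifP => // _; split=> //=.
  exact: free_server_stob_deliver.
- by case=> cc _; rewrite /step /= cc; apply: upd_c; apply: free_client_act.
- by case=> cb _; rewrite /step /= cb; apply: upd_b; apply: free_broker_act.
- by case=> cj _; rewrite /step /= cj; split=> //=; apply: free_server_complete.
- case=> np unf; rewrite /step /= (negPf np); split=> //=.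
  (* By [unforged] the signature would occur in an output of [i0] before [t], but all earlier
     outputs are free of it. *)
  have : wsig i0 k0 \notin flatten (map (@sigs_of_output S) o).
    apply/negP => /unf/(_ ci0)[t' lt_t [y [n [_ Ey]] y_sg]].
    by have := all_onth (fo _ lt_t) Ey; rewrite /free_output y_sg.
  elim: (o) => //= y l IHl; rewrite mem_cat negb_or => /andP[fy /IHl->].
  by rewrite andbT.
Qed.

(** The contrapositive of [free_execution]; the bound is [t.+1] because the state of the signer is
    examined after its event. *)
Lemma witness_origin t : ~~ all (free_output i0 k0) (outputs ev t) ->
  exists2 u, u <= t.+1 & witnessing u.
Proof.
case: (boolP [exists u : 'I_t.+2, witnessing u]) => [/existsP[u wu] _|].
  by exists (u : nat); rewrite // -ltnS.
rewrite negb_exists => /forallP nw; case: (@free_execution t.+1).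
  by move=> u le_u; apply: (nw (Ordinal (le_u : u < t.+2))).
by move=> _ /(_ t (leqnn _))->.
Qed.

End Origin.

Lemma server_ind i (P : nat -> sstate S -> Prop) : correct (Server i) ->
  P 0 (sstate0 S) ->
  (forall t st' o, P t (sv (conf ev t) i) ->
     server_step i t st' o -> P t.+1 st') ->
  forall t, P t (sv (conf ev t) i).
Proof.
move=> ci P0 Pstep; elim=> [//|t IH].
exact: Pstep IH (server_stepP t ci).
Qed.

Lemma server_sinv i t : correct (Server i) -> sinv (sv (conf ev t) i).
Proof.
move=> ci; apply: (server_ind (P := fun _ => @sinv S)) => //; first exact: sinv0.
move=> {}t st' o I [] // *.
- exact: sinv_receive.
- exact: sinv_stob_deliver.
- exact: sinv_complete.
Qed.

Lemma receive_stepE i t p x pk : correct (Server i) ->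
  ev t = Receive p (Server i) x pk ->
  sv (conf ev t.+1) i = (server_receive i (sv (conf ev t) i) p x).1 /\
  outputs ev t = (server_receive i (sv (conf ev t) i) p x).2.
Proof.
by move=> ci E; rewrite /outputs /= E /step /= ci /= /upd eqxx.
Qed.

Lemma stob_stepE i t M : correct (Server i) -> ev t = StobDeliver i M ->
  sv (conf ev t.+1) i = (server_stob_deliver (sv (conf ev t) i) M).1 /\
  outputs ev t = (server_stob_deliver (sv (conf ev t) i) M).2.
Proof.
by move=> ci E; rewrite /outputs /= E /step /= ci /= /upd eqxx.
Qed.

Lemma complete_stepE i t : correct (Server i) -> ev t = ServerComplete i ->
  sv (conf ev t.+1) i = (server_complete i (sv (conf ev t) i)).1 /\
  outputs ev t = (server_complete i (sv (conf ev t) i)).2.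
Proof.
by move=> ci E; rewrite /outputs /= E /step /= ci /= /upd eqxx.
Qed.

Lemma hist_step_stob i t M : correct (Server i) -> ev t = StobDeliver i M ->
  hist (sv (conf ev t.+1) i) = push (hist (sv (conf ev t) i)) M.
Proof.
move=> ci /(stob_stepE ci)[-> _].
exact: hist_stob_deliver (server_sinv t ci).
Qed.

Lemma hist_step_other i t : correct (Server i) ->
  (forall M, ev t <> StobDeliver i M) ->
  hist (sv (conf ev t.+1) i) = hist (sv (conf ev t) i).
Proof.
move=> ci ns; case: (server_stepP t ci) => [//|p x pk _|M /ns//|_ _].
  exact: hist_receive.
exact: hist_complete.
Qed.

Lemma scompleted_step i t : correct (Server i) ->
  scompleted (sv (conf ev t.+1) i) = scompleted (sv (conf ev t) i) \/
  exists k s, [/\ ev t = ServerComplete i,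
    spool (sv (conf ev t) i) = k :: s, sbatches (sv (conf ev t) i) k &
    scompleted (sv (conf ev t.+1) i) = k :: scompleted (sv (conf ev t) i)].
Proof.
move=> ci; case: (server_stepP t ci) => [|p x pk _|[[b r] W] _|E en].
- by left.
- by left; apply: scompleted_receive.
- by left=> /=; case: ifP.
right; move: en; rewrite /server_complete_enabled /server_complete.
case: (spool _) => // k s; case Ek: (sbatches _ k) => [B|] // _.
by exists k, s; rewrite Ek; case: complete_entries => -[].
Qed.

Lemma monotone_time (T : Type) (le : T -> T -> Prop) (g : nat -> T) :
  (forall x, le x x) -> (forall y x z, le x y -> le y z -> le x z) ->
  (forall t, le (g t) (g t.+1)) -> forall t u, t <= u -> le (g t) (g u).
Proof.
move=> le_refl le_trans le_g t u /subnKC <-; elim: (u - t) => [|n IH].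
  by rewrite addn0.
by rewrite addnS; apply: le_trans IH (le_g _).
Qed.

Lemma hist_mono i t u : correct (Server i) -> t <= u ->
  prefix (hist (sv (conf ev t) i)) (hist (sv (conf ev u) i)).
Proof.
move=> ci; move: t u; apply: (@monotone_time _ (fun x y => prefix x y)).
- exact: prefix_refl.
- exact: prefix_trans.
move=> t; case: (server_stepP t ci) => [|p x pk _|M _|_ _].
- exact: prefix_refl.
- by rewrite hist_receive prefix_refl.
- rewrite hist_stob_deliver; last exact: server_sinv.
  by have := prefix_foldl_push (hist (sv (conf ev t) i)) [::] [:: M].
- by rewrite hist_complete prefix_refl.
Qed.

Lemma snum_mono i b t u : correct (Server i) -> t <= u ->
  snum (sv (conf ev t) i) b <= snum (sv (conf ev u) i) b.
Proof.
move=> ci /(hist_mono ci)/prefixP[s E].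
rewrite !(sinv_snum (server_sinv _ ci)) E count_cat ltnS leq_addr //.
Qed.

Lemma scompleted_mono i t u : correct (Server i) -> t <= u ->
  suffix (scompleted (sv (conf ev t) i)) (scompleted (sv (conf ev u) i)).
Proof.
move=> ci; move: t u; apply: (@monotone_time _ (fun x y => suffix x y)).
- exact: suffix_refl.
- exact: suffix_trans.
move=> t; have [->|[k [s [_ _ _ ->]]]] := scompleted_step t ci.
  exact: suffix_refl.
by rewrite -cat1s suffix_suffix.
Qed.

Definition ncompleted i t := size (scompleted (sv (conf ev t) i)).

Lemma ncompleted_mono i t u : correct (Server i) -> t <= u ->
  ncompleted i t <= ncompleted i u.
Proof. by move=> ci /(scompleted_mono ci)/size_suffix. Qed.

(** More than [faults S] signers cannot all be Byzantine. *)
Lemma certified_correct (W : aggregate S) k : certifies W (SWitness k) ->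
  exists2 i : server S, correct (Server i) & wsig i k \in sigs_of_aggregate W.
Proof.
case: W => l x; rewrite /certifies /= => /andP[/eqP-> big].
have: ~~ ([set i : server S | Server i \in l] \subset
          [set i | ~~ correct (Server i)]).
  by apply: contraL big => /subset_leq_card/leq_trans/(_ (few_byzantine S)); rewrite -leqNgt.
case/subsetPn=> i; rewrite !inE negbK => il ci.
by exists i; rewrite // wsig_aggregate il eqxx.
Qed.

(** By integrity some server, possibly Byzantine, had broadcast the message before [t], so every
    signature in it had been emitted by then. *)
Lemma delivered_witness i i' t b r W k :
  correct (Server i) -> correct (Server i') -> ev t = StobDeliver i (b, r, W) ->
  wsig i' k \in sigs_of_aggregate W -> exists2 u, u <= t & witnessing i' k u.
Proof.
move=> ci ci' Ed Wi'.
have [j [u lt_u [n [_ En]]]] := stob_integrity (exec_stob exec) ci Ed.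
have [|v le_v wv] := @witness_origin i' k ci' u.
  by apply/negP => /(fun f => all_onth f En)/negP; apply.
by exists v; rewrite // (leq_trans le_v).
Qed.

(* Whoever witnessed the n-th batch of a broker had STOB-delivered the previous
   one, before the witness certificate existed; total order does the rest. *)
Lemma delivered_number i t b r W n : correct (Server i) ->
  ev t = StobDeliver i (b, r, W) -> certifies W (SWitness (r, b, n)) ->
  n <= snum (sv (conf ev t) i) b.
Proof.
elim/ltn_ind: t i r W n => t IH i r W n ci Ed cW.
have [i' ci' Wi'] := certified_correct cW.
have [u le_u /andP[_ /eqP/= En]] := delivered_witness ci ci' Ed Wi'.
case: n cW En Wi' => [|n] cW En Wi' //.
have [E0|n_gt0] := posnP n; first by rewrite E0 (sinv_snum (server_sinv _ ci)).
(* The time [v] at which the witness [i'] moved its expected number from [n] to [n.+1], found by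
   going back from [u]. *)
have [v lt_v [r' [W' [Ev cW' Esn]]]] : exists2 v, v < u &
    exists r' W', [/\ ev v = StobDeliver i' (b, r', W'),
      certifies W' (SWitness (r', b, n)) & snum (sv (conf ev v) i') b = n].
  elim: u {le_u} En => [|u IHu] En; first by case: En n_gt0 => <-.
  case: (snum (sv (conf ev u) i') b =P n.+1) => [/IHu[v lt_v Hv]|ne].
    by exists v; first exact: leqW.
  exists u => //; move: En.
  case: (server_stepP u ci') => [/ne//|p x pk _|[[b' r'] W'] EM|_ _].
  - by rewrite snum_receive => /ne.
  - rewrite /=; case: ifP => [cW'|_ /ne//] /=; rewrite /upd.
    case: eqP => [Eb [En]|_ /ne//]; exists r', W'.
    by rewrite Eb; rewrite En in cW'; split.
  - rewrite (sinv_snum (sinv_complete i' (server_sinv u ci'))) hist_complete.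
    by rewrite -(sinv_snum (server_sinv u ci')) => /ne.
have neM : (b, r, W) <> (b, r', W') :> stobmsg S.
  case=> Er EW; move: cW cW'; rewrite EW Er /certifies.
  case/andP=> /eqP-> _ /andP[/eqP[] E _].
  by move/eqP: E; rewrite gtn_eqF.
(* The certificate [W] contains the signature of [i'], for which [i'] had to expect [n.+1]; up to
   [v] it expected at most [n]. *)
have nM w : w < v -> ~ stob_delivers ev w i' (b, r, W).
  move=> lt_w /delivered_witness/(_ Wi')[] // x le_x /andP[_ /eqP/= Ex].
  have := snum_mono b ci' (leq_trans le_x (ltnW lt_w)).
  by rewrite Esn Ex ltnn.
(* As [i'] delivered the certificate number [n] first, total order forces [i] to deliver it before
   [t]; the search is over a finite type so that it can be decided. *)
have [w lt_w Ew] : exists2 w, w < t & ev w = StobDeliver i (b, r', W').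
  case: (boolP [exists w : 'I_t, if ev w is StobDeliver j M then
      (j == i) && (M == (b, r', W') :> broker S * Defs.root S * aggregate S)
      else false]) => [/existsP[w]|].
    case Ew: (ev w) => [||j M||||] // /andP[/eqP Ej /eqP EM].
    by exists (w : nat); rewrite // Ew Ej EM.
  rewrite negb_exists => /forallP nw; exfalso.
  apply: (stob_total_order (exec_stob exec) ci' ci (nesym neM) Ev nM).
  exists t => // w lt_w Ew; have /negP := nw (Ordinal lt_w).
  by rewrite /= Ew !eqxx.
have le_n := IH w lt_w i r' W' n ci Ew cW'.
apply: leq_trans (snum_mono b ci lt_w).
have [-> _] := stob_stepE ci Ew; rewrite /=.
(* By induction [i] expects at least [n] at [w]: either this delivery increments the number, or it
   is ignored because the number already exceeds [n]. *)
case: ifP => [_|/negbT ncW]; first by rewrite /= /upd eqxx ltnS.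
rewrite ltn_neqAle le_n andbT; apply: contra ncW => /eqP <- //.
Qed.

End Execution.

(** * Agreement on the queues *)

Section Agreement.
Context {S : system} (ev : nat -> event S) (exec : execution ev).

Definition smsg : eqType := (broker S * Defs.root S * aggregate S)%type.

(* The STOB messages delivered to [i] before time [t], without repetitions and
   in the order of their first deliveries. *)
Fixpoint dlog i t : seq smsg :=
  if t is u.+1 then
    if ev u is StobDeliver j M then
      if (j == i) && ((M : smsg) \notin dlog i u) then rcons (dlog i u) M
      else dlog i u
    else dlog i u
  else [::].

Lemma dlog_mono i t u : t <= u -> prefix (dlog i t) (dlog i u).
Proof.
move: t u; apply: (@monotone_time _ (fun x y => prefix x y)).
- exact: prefix_refl.
- exact: prefix_trans.
move=> t /=; case: (ev t) => [||j M||||] *; rewrite ?prefix_refl //.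
by case: ifP => _; rewrite ?prefix_rcons ?prefix_refl.
Qed.

Lemma dlog_uniq i t : uniq (dlog i t).
Proof.
elim: t => //= t IH; case: (ev t) => [||j M||||] * //.
by case: ifP => // /andP[_ nM]; rewrite rcons_uniq nM.
Qed.

Lemma mem_dlog i t M : stob_delivers ev t i M -> (M : smsg) \in dlog i t.+1.
Proof.
rewrite /stob_delivers /= => ->; rewrite eqxx /=.
by case: ifP => [_|/negbFE//]; rewrite mem_rcons mem_head.
Qed.

Lemma dlog_split i t l (M : smsg) s : dlog i t = l ++ M :: s ->
  exists u, [/\ u < t, stob_delivers ev u i M & dlog i u = l].
Proof.
elim: t s => [|t IH] s /=; first by case: l.
have old : dlog i t = l ++ M :: s ->
    exists u, [/\ u < t.+1, stob_delivers ev u i M & dlog i u = l].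
  by case/IH=> u [lt_u Eu El]; exists u; split=> //; apply: leqW.
case E: (ev t) => [||j M'||||] //; case: ifP => // /andP[/eqP Ej _].
case/lastP: s {old} => [|s x].
  rewrite cats1 => /eqP; rewrite eqseq_rcons => /andP[/eqP El /eqP EM].
  by exists t; split; rewrite // /stob_delivers E Ej EM.
rewrite -rcons_cons -rcons_cat => /eqP.
rewrite eqseq_rcons => /andP[/eqP/IH[u [lt_u Eu El]] _].
by exists u; split=> //; apply: leqW.
Qed.

Lemma dlog_notin i t (M : smsg) u :
  M \notin dlog i t -> u < t -> ~ stob_delivers ev u i M.
Proof.
move=> nM lt_u /mem_dlog Mu; case/negP: nM.
exact: (mem_prefix (dlog_mono i lt_u) Mu).
Qed.

(** At a first divergence, [i] would have delivered [x] without [y], and [j] would have delivered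
    [y] before [x]. *)
Lemma dlog_comparable i j t t' : correct (Server i) -> correct (Server j) ->
  prefix (dlog i t) (dlog j t') || prefix (dlog j t') (dlog i t).
Proof.
move=> ci cj; have [//|[l [x [y [s1 [s2 [nxy E1 E2]]]]]]] :=
  not_prefix_split (dlog i t) (dlog j t').
have [u [_ Eu Elu]] := dlog_split E1; have [v [_ Ev Elv]] := dlog_split E2.
have nx : x \notin l.
  by have := dlog_uniq i t; rewrite E1 cat_uniq /= negb_or => /and3P[_ /andP[]].
have ny : y \notin l.
  by have := dlog_uniq j t'; rewrite E2 cat_uniq /= negb_or => /and3P[_ /andP[]].
exfalso; apply: (stob_total_order (exec_stob exec) ci cj nxy Eu).
  by move=> w; apply: dlog_notin; rewrite Elu.
by exists v => // w; apply: dlog_notin; rewrite Elv.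
Qed.

(** Agreement applies to each of the finitely many logged messages; [t'] is the maximum of the
    resulting times. *)
Lemma dlog_agreement i j t : correct (Server i) -> correct (Server j) ->
  exists t', prefix (dlog i t) (dlog j t').
Proof.
move=> ci cj.
have [t' sub] : exists t', {subset dlog i t <= dlog j t'}.
  have: all (mem (dlog i t)) (dlog i t) by apply/allP.
  elim: {2 3}(dlog i t) => [|M l IH] /=; first by exists 0.
  case/andP=> Mi /IH[t1 sub1]; case/path.splitPr EM: _ / Mi => [l1 l2].
  have [u [_ Eu _]] := dlog_split EM.
  have [v Ev] := stob_agreement (exec_stob exec) ci cj Eu.
  exists (maxn t1 v.+1) => x; rewrite inE => /orP[/eqP->|/sub1 xt].
    exact: (mem_prefix (dlog_mono j (leq_maxr t1 v.+1)) (mem_dlog Ev)).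
  exact: (mem_prefix (dlog_mono j (leq_maxl t1 v.+1)) xt).
(* If the log of [j] is the prefix, it is still no shorter, because the log of [i] has no
   repetitions; so the two are equal. *)
exists t'; case/orP: (dlog_comparable t t' ci cj) => // /prefixP[s E].
have := uniq_leq_size (dlog_uniq i t) sub.
rewrite E size_cat -[leqRHS]addn0 leq_add2l leqn0 => /nilP->.
by rewrite cats0 prefix_refl.
Qed.

(* A repeated delivery is ignored: by [delivered_number] the expected number
   had reached that of the certificate by the first delivery. *)
Lemma push_delivered i u t M : correct (Server i) -> u < t ->
  ev u = StobDeliver i M -> push (hist (sv (conf ev t) i)) M = hist (sv (conf ev t) i).
Proof.
move=> ci lt_u Eu; case: M Eu => [[b r] W] Eu /=; case: ifP => // cW.
have It := server_sinv exec t ci; rewrite -(sinv_snum It) in cW.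
have le_n := delivered_number exec ci Eu cW.
have le_t := snum_mono exec b ci lt_u.
have le_u := snum_mono exec b ci (ltnW lt_u).
(* If [W] still matched at [t], the expected number would be the same at [u], but then the delivery
   at [u] would have increased it. *)
have Eut : snum (sv (conf ev u) i) b = snum (sv (conf ev t) i) b.
  by apply/eqP; rewrite eqn_leq le_u.
have [Eu1 _] := stob_stepE ci Eu; move: le_t.
by rewrite Eu1 /= Eut cW /= /upd eqxx ltnn.
Qed.

(** Repetitions being harmless, the queue is a function of the log, and the prefix order passes from
    logs to queues. *)
Lemma hist_dlog i t : correct (Server i) ->
  hist (sv (conf ev t) i) = foldl push [::] (dlog i t).
Proof.
move=> ci; elim: t => // t IH.
have other : (forall M, ev t <> StobDeliver i M) ->
    hist (sv (conf ev t.+1) i) = foldl push [::] (dlog i t).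
  by move=> ns; rewrite (hist_step_other exec ci ns).
case E: (ev t) => [||j M||||] *; rewrite [dlog i t.+1]/= E;
  try by apply: other => ?; rewrite E.
case: eqP => [Ej|nj] /=; last by apply: other => M'; rewrite E => -[/nj].
rewrite Ej in E; rewrite (hist_step_stob exec ci E); case: ifP => [_|/negbFE Mt].
  by rewrite foldl_rcons -IH.
rewrite -IH; case/path.splitPr EM: _ / Mt => [l1 l2].
have [u [lt_u Eu _]] := dlog_split EM.
exact: push_delivered Eu.
Qed.

Lemma hist_prefix i j t t' : correct (Server i) -> correct (Server j) ->
  prefix (dlog i t) (dlog j t') ->
  prefix (hist (sv (conf ev t) i)) (hist (sv (conf ev t') j)).
Proof.
move=> ci cj /prefixP[s E]; rewrite !hist_dlog // E.
exact: prefix_foldl_push.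
Qed.

Lemma hist_comparable i j t t' : correct (Server i) -> correct (Server j) ->
  prefix (hist (sv (conf ev t) i)) (hist (sv (conf ev t') j)) ||
  prefix (hist (sv (conf ev t') j)) (hist (sv (conf ev t) i)).
Proof.
move=> ci cj; case/orP: (dlog_comparable t t' ci cj) => /hist_prefix -> //.
by rewrite orbT.
Qed.

Lemma hist_agreement i j t : correct (Server i) -> correct (Server j) ->
  exists t', prefix (hist (sv (conf ev t) i)) (hist (sv (conf ev t') j)).
Proof.
by move=> ci cj; have [t' /hist_prefix] := dlog_agreement t ci cj; exists t'; auto.
Qed.

Lemma hist_inj i j t t' k k' : correct (Server i) -> correct (Server j) ->
  k \in hist (sv (conf ev t) i) -> k' \in hist (sv (conf ev t') j) ->
  k.1.2 = k'.1.2 -> k.2 = k'.2 -> k = k'.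
Proof.
move=> ci cj ki kj.
case/orP: (hist_comparable t t' ci cj) => /mem_prefix sub.
  by apply: numbered_inj (sinv_numbered (server_sinv exec t' cj)) _ _; auto.
by apply: numbered_inj (sinv_numbered (server_sinv exec t ci)) _ _; auto.
Qed.

(** An acceptance only compares a number with the count of completed batches. This count yields a
    key of the same broker and number completed by [j], which [hist_inj] identifies with [k] because
    [k] is in the history of [i]. *)
Lemma accepted_completed i j t t' k : correct (Server i) -> correct (Server j) ->
  j \in saccepts (sv (conf ev t) i) k ->
  k \in hist (sv (conf ev t') i) ->
  exists2 u, u < t & k \in scompleted (sv (conf ev u) j).
Proof.
move=> ci cj acc kh.
suff [u lt_u le_k] : exists2 u, u < t & k.2 <= sdone (sv (conf ev u) j) k.1.2.
  exists u => //; have Ij := server_sinv exec u cj.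
  rewrite (sinv_sdone Ij) in le_k.
  have /andP[k_gt0 _] := numbered_bound (sinv_numbered (server_sinv exec t' ci)) kh.
  have Nj : numbered (rev (scompleted (sv (conf ev u) j))).
    exact: numbered_catl (sinv_numbered Ij).
  have [|k' k'c [Eb En]] := numbered_exists Nj (b := k.1.2) (n := k.2).
    by rewrite k_gt0 count_rev.
  rewrite mem_rev in k'c.
  by rewrite (hist_inj ci cj kh (completed_hist k'c)).
elim: t acc => [|t IH] //.
have old : j \in saccepts (sv (conf ev t) i) k ->
    exists2 u, u < t.+1 & k.2 <= sdone (sv (conf ev u) j) k.1.2.
  by case/IH=> u lt_u; exists u => //; apply: leqW.
case: (server_stepP exec t ci) => [//|p x [t1 n] E|M _|_ _].
- case/saccepts_receive=> [//|[Ep Ex]]; rewrite {}Ep {}Ex in E.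
  have := exec_admissible exec t; rewrite /admissible E => -[lt_t1].
  move=> em; have [n' En'] : exists n', onth (server_outputs ev j t1) n' =
      Some (Send (Server i) (CollectionAccept k)).
    by apply: server_emits; exists n.
  exists t1; first exact: leqW.
  have := onth_In En'; case: (server_stepP exec t1 cj) => [//|q y pk _|M _|_ _].
  + exact: sent_accept_receive.
  + by move/(sent_accept_stob (M := M)).
  + by move/sent_accept_complete.
- by case: M => [[b r] W] /=; case: ifP.
- rewrite /server_complete; case: (spool _) => // k' s.
  by case: (sbatches _ k') => // B; case: complete_entries => -[].
Qed.

End Agreement.

(** * Liveness and conclusion *)

Lemma deliver_complete (S : system) i (st : sstate S) k s B c m :
  spool st = k :: s -> sbatches st k = Some B ->
  List.In (Deliver c m) (server_complete i st).2 <->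
  List.In (Deliver c m) (complete_entries (slast st) (submitted B)).2.
Proof.
move=> Ek EB; rewrite /server_complete Ek EB.
case: complete_entries => -[u v] w /=; split=> [/List.in_app_iff[//|/=[//|]]|].
  by case/to_servers_In.
by move=> H; apply/List.in_app_iff; left.
Qed.

Lemma to_servers_onth (S : system) (i : server S) (x : netmsg S) :
  exists n, onth (to_servers x) n = Some (Send (Server i) x).
Proof.
apply: In_onth; rewrite /to_servers.
have : i \in enum (server S) by rewrite mem_enum.
by elim: (enum _) => //= j l IH; rewrite inE => /orP[/eqP->|/IH]; [left | right].
Qed.

Lemma cat_cons_prefix (T : eqType) (a b s1 s2 : seq T) x y :
  prefix (a ++ x :: s1) (b ++ y :: s2) -> size a = size b -> a = b /\ x = y.
Proof.
case/prefixP=> z /eqP E Es; move: E; rewrite -catA cat_cons.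
by rewrite eqseq_cat // eqseq_cons => /and3P[/eqP-> /eqP->].
Qed.

Section Liveness.
Context {S : system} (ev : nat -> event S) (exec : execution ev).

(* A correct server only forgets a batch that all servers claim to have
   completed, and those that are correct are telling the truth. *)
Lemma stored_mono i j t u k B : correct (Server i) -> correct (Server j) ->
  t <= u -> k \notin scompleted (sv (conf ev u) j) ->
  sbatches (sv (conf ev t) i) k = Some B ->
  sbatches (sv (conf ev u) i) k = Some B.
Proof.
move=> ci cj /subnKC <-; elim: (u - t) => [|n IH]; first by rewrite addn0.
rewrite addnS => nk EB.
have {IH}EB : sbatches (sv (conf ev (t + n)) i) k = Some B.
  apply: IH EB; apply: contra nk.
  have /suffixP[s ->] := scompleted_mono exec cj (leqnSn (t + n)).
  by rewrite mem_cat => ->; rewrite orbT.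
have I := server_sinv exec (t + n) ci.
have := @accepted_completed _ _ exec i j (t + n).+1 (t + n) k ci cj.
case: (server_stepP exec (t + n) ci) => [//|p x pk _|M _|_ _].
(* A deletion would need the acceptance of [j], which would then have completed [k]. *)
- have [//|[kc acc]] := stored_receive i p x I EB.
  case/(_ (acc j) (completed_hist kc))=> w; rewrite ltnS => le_w kw.
  case/negP: nk.
  have /suffixP[s ->] := scompleted_mono exec cj (leqW le_w).
  by rewrite mem_cat kw orbT.
- by rewrite stored_stob_deliver.
- by rewrite stored_complete.
Qed.

Lemma known_mono i t u : correct (Server i) -> t <= u ->
  {subset sknown (sv (conf ev t) i) <= sknown (sv (conf ev u) i)}.
Proof.
move=> ci; move: t u.
apply: (@monotone_time _ (fun x y : sstate S => {subset sknown x <= sknown y})).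
- by move=> x a.
- by move=> y x z xy yz a /xy/yz.
move=> t a; case: (server_stepP exec t ci) => [//|p x pk _|M _|_ _].
- exact: known_receive.
- by rewrite known_stob_deliver.
- by rewrite known_complete.
Qed.

Lemma avail_mono i j t u k : correct (Server i) -> correct (Server j) ->
  t <= u -> k \notin scompleted (sv (conf ev u) j) ->
  avail (sv (conf ev t) i) k -> avail (sv (conf ev u) i) k.
Proof.
move=> ci cj le_t nk; rewrite /avail.
case E: (sbatches (sv (conf ev t) i) k) => [B|] //.
rewrite (stored_mono ci cj le_t nk E); apply: sub_all => id /=.
exact: known_mono.
Qed.

Lemma hist_pushed i t k : correct (Server i) ->
  k \in hist (sv (conf ev t) i) ->
  exists u W, [/\ u < t, ev u = StobDeliver i (k.1.2, k.1.1, W),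
    certifies W (SWitness k) & snum (sv (conf ev u) i) k.1.2 = k.2].
Proof.
move=> ci; elim: t => [//|t IH].
have old : k \in hist (sv (conf ev t) i) -> exists u W,
    [/\ u < t.+1, ev u = StobDeliver i (k.1.2, k.1.1, W),
    certifies W (SWitness k) & snum (sv (conf ev u) i) k.1.2 = k.2].
  by case/IH=> u [W [lt_u Eu cW En]]; exists u, W; split=> //; apply: leqW.
have I := server_sinv exec t ci.
case: (server_stepP exec t ci) => [//|p x pk _|M E|_ _].
- by rewrite hist_receive.
- rewrite hist_stob_deliver //; case: M E => [[b r] W] E /=.
  rewrite -(sinv_snum I); case: ifP => // cW.
  rewrite mem_rcons inE => /orP[/eqP Ek|//].
  by exists t, W; rewrite Ek.
- by rewrite hist_complete.
Qed.

(** * Eventual completion of the head of a queue *)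

Section Head.
Variables (j : server S) (t : nat) (k : key S) (s : seq (key S)).
Hypotheses (cj : correct (Server j)) (head : spool (sv (conf ev t) j) = k :: s).

Let n := ncompleted ev j t.

(** The count of completions serves as a clock: while it does not exceed [n], its value at [t], the
    head is still waiting. *)
Lemma head_notin u : ncompleted ev j u <= n ->
  k \notin scompleted (sv (conf ev u) j).
Proof.
have nk : k \notin scompleted (sv (conf ev t) j).
  have := sinv_numbered (server_sinv exec t cj); rewrite /hist head.
  by move/numbered_notin; rewrite mem_rev.
move=> le_u; case: (leqP u t) => [le_t|/ltnW le_t].
  apply: contra nk; have /suffixP[l ->] := scompleted_mono exec cj le_t.
  by rewrite mem_cat => ->; rewrite orbT.
have /suffixP[l E] := scompleted_mono exec cj le_t.
move: le_u; rewrite /n /ncompleted E size_cat -[leqRHS]add0n leq_add2r leqn0.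
by move/nilP->.
Qed.

Lemma head_spool u : t <= u -> ncompleted ev j u <= n ->
  exists s', spool (sv (conf ev u) j) = k :: s'.
Proof.
move=> le_t le_u; have /suffixP[l E] := scompleted_mono exec cj le_t.
have El : l = [::].
  move: le_u; rewrite /n /ncompleted E size_cat -[leqRHS]add0n leq_add2r leqn0.
  by move/nilP.
have /prefixP[z] := hist_mono exec cj le_t.
rewrite /hist E El head -catA => /eqP; rewrite eqseq_cat // eqxx /= => /eqP ->.
by exists (s ++ z).
Qed.

Lemma head_stored : exists2 u, t <= u &
  n < ncompleted ev j u \/ sbatches (sv (conf ev u) j) k.
Proof.
have done u : n < ncompleted ev j u -> exists2 u, t <= u &
    n < ncompleted ev j u \/ sbatches (sv (conf ev u) j) k.
  move=> lt_u; exists (maxn t u); first exact: leq_maxl.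
  by left; apply: leq_trans lt_u (ncompleted_mono exec cj (leq_maxr _ _)).
have stored u : sbatches (sv (conf ev u) j) k -> exists2 u, t <= u &
    n < ncompleted ev j u \/ sbatches (sv (conf ev u) j) k.
  case: (leqP t u) => [le_t ku|/ltnW le_u]; first by exists u; auto.
  case EB: (sbatches _ k) => [B|] // _; exists t => //; right.
  by rewrite (stored_mono cj cj le_u (head_notin (leqnn _)) EB).
have kh : k \in hist (sv (conf ev t) j).
  by rewrite /hist head mem_cat mem_head orbT.
have [u0 [W [lt_u0 E0 cW En]]] := hist_pushed cj kh.
have [st1 out0] := stob_stepE cj E0.
have Ek : (k.1.1, k.1.2, snum (sv (conf ev u0) j) k.1.2) = k.
  by rewrite En; case: (k) => -[].
(* If the expected root was the delivered one, the batch was stored already; otherwise it was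
   requested from every server, in particular from the correct witness [i']. *)
case: (sroot (sv (conf ev u0) j) k.1.2 =P Some k.1.1) => [Er|nr].
  apply: (stored u0); rewrite -Ek.
  exact: sinv_root (server_sinv exec u0 cj) _ _ Er.
have out0' : outputs ev u0 = to_servers (RequestBatch k).
  by rewrite out0 /= Ek cW; case: eqP.
have [i' ci' Wi'] := certified_correct cW.
have [w le_w /andP[av_w _]] := delivered_witness exec cj ci' E0 Wi'.
have [n0 En0] := to_servers_onth i' (RequestBatch k).
have em0 : emits_at ev u0 n0 (Server j) (Send (Server i') (RequestBatch k)).
  by split; rewrite ?out0' // E0.
have [v Ev] := link_delivery (exec_links exec) cj ci' em0.
have lt_v : u0 < v by have := exec_admissible exec v; rewrite /admissible Ev => -[].
case: (ltnP n (ncompleted ev j v)) => [/done//|/head_notin nk_v].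
(* The witness had the batch by the time of the delivery, and it cannot have deleted it since, as
   [j] has not completed [k]. *)
have av_v := avail_mono ci' cj (leq_trans le_w (ltnW lt_v)) nk_v av_w.
have [B EB] : exists B, sbatches (sv (conf ev v) i') k = Some B.
  by move: av_v; rewrite /avail; case: sbatches => // B; exists B.
have [_ out_v] := receive_stepE ci' Ev.
rewrite /= /server_request EB in out_v.
set reply := BatchReply _ _ _ in out_v.
have em_v : emits_at ev v 0 (Server i') (Send (Server j) reply).
  by split; rewrite ?out_v // Ev.
have [x Ex] := link_delivery (exec_links exec) ci' cj em_v.
have lt_x : v < x by have := exec_admissible exec x; rewrite /admissible Ex => -[].
case: (ltnP n (ncompleted ev j x)) => [/done//|/head_notin nk_x].
(* Replies are only accepted for keys in the pool: [k] was pushed at [u0] and is not completed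
   yet. *)
have k_spool : k \in spool (sv (conf ev x) j).
  have : k \in hist (sv (conf ev x) j).
    apply: (mem_prefix (hist_mono exec cj (leq_trans lt_v (ltnW lt_x)))).
    rewrite (hist_step_stob exec cj E0) /= -(sinv_snum (server_sinv exec u0 cj)).
    by rewrite Ek cW mem_rcons mem_head.
  by rewrite mem_cat mem_rev (negPf nk_x).
apply: (stored x.+1); have [-> _] := receive_stepE cj Ex.
exact: reply_stored (server_sinv exec v ci') av_v EB k_spool.
Qed.

(** Once the batch is stored, completion stays enabled until it happens, so weak fairness
    applies. *)
Lemma head_completed : exists u, n < ncompleted ev j u.
Proof.
have [u le_u [lt_n|st_u]] := head_stored; first by exists u.
case: (ltnP n (ncompleted ev j u)) => [|le_n]; first by exists u.
have enabled v : u <= v -> ncompleted ev j v <= n ->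
    server_complete_enabled (sv (conf ev v) j).
  move=> le_v le_vn; rewrite /server_complete_enabled.
  have [s' ->] := head_spool (leq_trans le_u le_v) le_vn.
  case EB: (sbatches _ k) st_u => [B|] // _.
  by rewrite (stored_mono cj cj le_v (head_notin le_vn) EB).
have [v le_v tk] := fair_server (exec_fairness exec) cj (enabled u (leqnn u) le_n).
case: (ltnP n (ncompleted ev j v)) => [|le_vn]; first by exists v.
have en := enabled v le_v le_vn; case: tk => [Ev|/(_ en)//].
exists v.+1; have [st' _] := complete_stepE cj Ev; rewrite /ncompleted st'.
move: en; rewrite /server_complete_enabled /server_complete.
have [s' ->] := head_spool (leq_trans le_u le_v) le_vn.
case: (sbatches _ k) => [B|] // _; case: complete_entries => -[? ?] ? /=.
by rewrite ltnS; apply: (ncompleted_mono exec cj (leq_trans le_u le_v)).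
Qed.

End Head.

Lemma hist_completed_next j n t : correct (Server j) ->
  n < size (hist (sv (conf ev t) j)) -> n <= ncompleted ev j t ->
  exists u, n < ncompleted ev j u.
Proof.
move=> cj lt_n; rewrite leq_eqVlt => /orP[/eqP En|]; last by exists t.
case E: (spool (sv (conf ev t) j)) => [|k s].
  by move: lt_n; rewrite En /hist E cats0 size_rev ltnn.
by have [u lt_u] := head_completed cj E; exists u; rewrite En.
Qed.

Lemma hist_completed j n t : correct (Server j) ->
  n < size (hist (sv (conf ev t) j)) -> exists u, n < ncompleted ev j u.
Proof.
move=> cj; elim: n => [|n IH] lt_n.
  exact: hist_completed_next lt_n _.
have [u lt_u] := IH (ltnW lt_n).
apply: (hist_completed_next (t := maxn t u)) => //.
  by apply: leq_trans lt_n (size_prefix (hist_mono exec cj (leq_maxl _ _))).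
by apply: leq_trans lt_u (ncompleted_mono exec cj (leq_maxr _ _)).
Qed.

(** Completions happen one at a time, so some event takes the count from [n] to [n.+1]. *)
Lemma completion_time j n t : correct (Server j) -> n < ncompleted ev j t ->
  exists u, [/\ ev u = ServerComplete j, ncompleted ev j u = n
               & server_complete_enabled (sv (conf ev u) j)].
Proof.
move=> cj; elim: t => [//|t IH].
have [E|[k [s [Et Ek st E]]]] := scompleted_step exec t cj.
  by rewrite {1}/ncompleted E => /IH.
rewrite {1}/ncompleted E /= ltnS leq_eqVlt => /orP[/eqP En|/IH//].
by exists t; split=> //; rewrite /server_complete_enabled Ek.
Qed.

End Liveness.

Theorem theorem3 (S : system) (ev : nat -> event S) (exec : execution ev)
    (i : server S) (c : client S) (m : message S) (t : nat)
    (i_correct : correct (Server i)) (del_i : delivers ev t i c m) :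
  forall j : server S, correct (Server j) ->
  exists t' : nat, delivers ev t' j c m.
Proof.
move=> j j_correct; have [n Dn] := server_emits del_i; have {n Dn} := onth_In Dn.
case: (server_stepP exec t i_correct) => [//|p x pk _|M _|_].
- by move/deliver_receive.
- by move/deliver_stob.
rewrite /server_complete_enabled; case Ek: (spool _) => [|k s] //.
case EB: (sbatches _ k) => [B|] // _ /(proj1 (deliver_complete i c m Ek EB)) del.
have [t1 /size_prefix le_t1] := hist_agreement exec t i_correct j_correct.
(* The position in the queue of the batch being completed; [j] is followed up to its completion of
   the same position. *)
have lt_n : ncompleted ev i t < size (hist (sv (conf ev t) i)).
  by rewrite /hist Ek size_cat size_rev /= -addSnnS leq_addr.
have [t2 lt_t2] := hist_completed exec j_correct (leq_trans lt_n le_t1).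
have [u [Eu En]] := completion_time exec j_correct lt_t2.
rewrite /server_complete_enabled; case Ek': (spool _) => [|k' s'] //.
case EB': (sbatches _ k') => [B'|] // _.
have [Ec Ekk] : rev (scompleted (sv (conf ev t) i)) =
    rev (scompleted (sv (conf ev u) j)) /\ k = k'.
  have := hist_comparable exec t u i_correct j_correct; rewrite /hist Ek Ek'.
  case/orP=> /cat_cons_prefix; rewrite !size_rev; first exact.
  by case=> // -> ->.
have Ii := server_sinv exec t i_correct.
have Ij := server_sinv exec u j_correct.
(* Equal completed keys have equal roots, hence equal contents in the same order, from which [slast]
   is computed. *)
have Elast : slast (sv (conf ev t) i) = slast (sv (conf ev u) j).
  have [l El ->] := sinv_last Ii; have [l' El' ->] := sinv_last Ij.
  by rewrite Ec -El' in El; rewrite (inj_map (@contents_root_inj S) El).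
have Esub : submitted B = submitted B'.
  apply: contents_root_inj; have [rB _] := sinv_batch Ii EB.
  by have [rB' _] := sinv_batch Ij EB'; rewrite -[LHS]/(batch_root B) rB Ekk -rB'.
rewrite Elast Esub in del.
have [n' En'] := In_onth (proj2 (deliver_complete j c m Ek' EB') del).
exists u, n'; split; first by rewrite Eu.
by have [_ ->] := complete_stepE j_correct Eu.
Qed.
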